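(* Let $G\subset\mathbb{K}[x_1,\dots,x_n][\partial_1,\dots,\partial_n]$ be a finite set which is a Gröbner basis with respect to $\prec$, such that every element of $G$ is primitive and the left ideal $\mathbb{K}(\mathbf{x})[\boldsymbol{\partial}]G$ is D-finite. Then the origin is an ordinary point of $G$ if and only if $G$ has $\mathrm{rank}(G)$ many $\mathbb{K}$-linearly independent formal power series solutions in $\mathbb{K}[[x_1,\dots,x_n]]$ whose initial exponents are exactly the elements of $\mathrm{PE}(G)$.
   Context: $\mathbb{K}$ is a field of characteristic zero. $\mathbb{K}(\mathbf{x})[\boldsymbol{\partial}]=\mathbb{K}(x_1,\dots,x_n)[\partial_1,\dots,\partial_n]$ is the ring of differential operators with rational function coefficients ($\partial_i\partial_j=\partial_j\partial_i$, $\partial_i f=f\partial_i+\partial f/\partial x_i$), and $\mathbb{K}[\mathbf{x}][\boldsymbol{\partial}]$ the subring with polynomial coefficients. A left ideal $I$ of $\mathbb{K}(\mathbf{x})[\boldsymbol{\partial}]$ is D-finite if $\mathbb{K}(\mathbf{x})[\boldsymbol{\partial}]/I$ is a finite-dimensional $\mathbb{K}(\mathbf{x})$-vector space. $\prec$ is a fixed graded term order on $\mathbb{N}^n$ (a total order compatible with addition, refining total degree), used both on terms $\boldsymbol{\partial}^{\mathbf{u}}$ and on terms $\mathbf{x}^{\mathbf{u}}$. Gröbner bases are taken in $\mathbb{K}(\mathbf{x})[\boldsymbol{\partial}]$ with respect to $\prec$ on $\boldsymbol{\partial}$-terms (reduced, up to multiplying elements by nonzero polynomials); for $P$ in $G$,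 its head term is its $\prec$-largest $\boldsymbol{\partial}$-term and its head coefficient (in $\mathbb{K}[\mathbf{x}]$) the coefficient of that term. Parametric terms $\mathrm{PT}(G)$ are the $\boldsymbol{\partial}$-terms not divisible by any head term of $G$; $\mathrm{rank}(G)=|\mathrm{PT}(G)|$; $\mathrm{PE}(G)$ is the set of exponent vectors of elements of $\mathrm{PT}(G)$. A point of $\overline{\mathbb{K}}^n$ is a singularity of $G=\{G_1,\dots,G_k\}$ if it is a zero of $\mathrm{lcm}$ of the head coefficients of $G_1,\dots,G_k$, and an ordinary point otherwise. An operator $\sum c_{\mathbf{u}}\boldsymbol{\partial}^{\mathbf{u}}$ with $c_{\mathbf{u}}\in\mathbb{K}[\mathbf{x}]$ is primitive if the gcd of its coefficients $c_{\mathbf{u}}$ is $1$. The initial exponent of a nonzero $f\in\mathbb{K}[[\mathbf{x}]]$ is the $\prec$-smallest exponent $\mathbf{w}$ with nonzero coefficient of $\mathbf{x}^{\mathbf{w}}$ in $f$. A formal power series solution of $G$ is $f\in\mathbb{K}[[\mathbf{x}]]$ with $P(f)=0$ for all $P\in G$. *)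

(* Defs.v *)
From HB Require Import structures.
From mathcomp Require Import all_boot all_order all_algebra.
From mathcomp Require Import fraction generic_quotient.
From mathcomp.multinomials Require Import mpoly.

Set Implicit Arguments.
Unset Strict Implicit.
Unset Printing Implicit Defensive.

Import Order.TTheory GRing.Theory.
Local Open Scope ring_scope.

Definition graded_term_order (n : nat) (lt : rel 'X_{1..n}) : Prop :=
  [/\ irreflexive lt,
      transitive lt,
      (forall u v : 'X_{1..n}, u != v -> lt u v || lt v u),
      (forall u v w : 'X_{1..n}, lt u v -> lt (u + w)%MM (v + w)%MM) &
      (forall u v : 'X_{1..n}, (mdeg u < mdeg v)%N -> lt u v)].

Definition lt_max (n : nat) (lt : rel 'X_{1..n}) (s : seq 'X_{1..n}) : 'X_{1..n} :=
  foldr (fun u acc => if lt acc u then u else acc) (head 0%MM s) s.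

Section Ops.
Variables (K : fieldType) (n : nat).

Definition kpoly := {mpoly K[n]}.
Definition kfrac := {fraction kpoly}.

(* An operator  sum_u c_u d^u  is represented by the (commutative) polynomial
   in the d-variables with coefficients c_u; its d^u coefficient is P@_u.
   The ring structure of D-operators is defined separately below. *)
Definition pop := {mpoly kpoly[n]}.
Definition rop := {mpoly kfrac[n]}.

Definition pop_to_rop (P : pop) : rop := map_mpoly (@FracField.tofrac kpoly) P.

Definition fderiv (i : 'I_n) (r : kfrac) : kfrac :=
  let p := \n_(repr r) in let q := \d_(repr r) in
  (@FracField.tofrac kpoly ((mderiv i p) * q - p * (mderiv i q))) / (@FracField.tofrac kpoly (q * q)).

Definition fderivm (w : 'X_{1..n}) (r : kfrac) : kfrac :=
  foldr (fun i => iter (w i) (fderiv i)) r (enum 'I_n).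

Definition mbinom (u w : 'X_{1..n}) : nat := (\prod_(i < n) 'C(u i, w i))%N.

(* multiplication in K(x)[d]:
   (a d^u)(b d^v) = sum_{w <= u} binom(u,w) a d^w(b) d^(u - w + v) *)
Definition rop_mul (P Q : rop) : rop :=
  \sum_(u <- msupp P) \sum_(v <- msupp Q)
    \sum_(w : 'X_{1..n < (mdeg u).+1} | (bmnm w <= u)%MM)
      ((P@_u * (mbinom u w)%:R * fderivm w (Q@_v)) *: 'X_[(u - w + v)%MM]).

Definition left_ideal (G : seq rop) (P : rop) : Prop :=
  exists R : 'I_(size G) -> rop, P = \sum_(k < size G) rop_mul (R k) (nth 0 G k).

Definition D_finite (G : seq rop) : Prop :=
  exists B : seq rop, forall P : rop,
    exists c : 'I_(size B) -> kfrac,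
      left_ideal G (P - \sum_(k < size B) c k *: nth 0 B k).

Variable lt : rel 'X_{1..n}.

Definition head_term (R : nzRingType) (P : {mpoly R[n]}) : 'X_{1..n} :=
  lt_max lt (msupp P).
Definition head_coef (P : pop) : kpoly := P@_(head_term P).

Definition groebner_basis (G : seq pop) : Prop :=
  (forall g, g \in G -> g != 0) /\
  forall P : rop, left_ideal (map pop_to_rop G) P -> P != 0 ->
    exists2 g, g \in G & (head_term g <= head_term P)%MM.

Definition reduced (G : seq pop) : Prop :=
  forall i j : 'I_(size G), i != j ->
    forall u, u \in msupp (nth 0 G i) -> ~~ (head_term (nth 0%R G j) <= u)%MM.

Definition param_exp (G : seq pop) (u : 'X_{1..n}) : Prop :=
  forall g, g \in G -> ~~ (head_term g <= u)%MM.

Definition pdvd (d p : kpoly) : Prop := exists q : kpoly, p = q * d.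

Definition primitive (P : pop) : Prop :=
  forall d : kpoly, (forall u, pdvd d P@_u) -> pdvd d 1.

Definition is_lcm (s : seq kpoly) (L : kpoly) : Prop :=
  (forall h, h \in s -> pdvd h L) /\
  (forall M, (forall h, h \in s -> pdvd h M) -> pdvd L M).

Definition origin_ordinary (G : seq pop) : Prop :=
  forall L, is_lcm (map head_coef G) L -> L.@[fun _ : 'I_n => (0 : K)] != 0.

Definition fps := 'X_{1..n} -> K.

Definition fps_deriv (u : 'X_{1..n}) (f : fps) : fps :=
  fun w => f (w + u)%MM * ((\prod_(i < n) ((w i + u i) ^_ (u i)))%N)%:R.

Definition fps_mulpoly (c : kpoly) (g : fps) : fps :=
  fun w => \sum_(v <- msupp c) (if (v <= w)%MM then c@_v * g (w - v)%MM else 0).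

Definition fps_apply (P : pop) (f : fps) : fps :=
  fun w => \sum_(u <- msupp P) fps_mulpoly P@_u (fps_deriv u f) w.

Definition fps_solution (G : seq pop) (f : fps) : Prop :=
  forall g, g \in G -> forall w, fps_apply g f w = 0.

Definition initial_exp (f : fps) (w : 'X_{1..n}) : Prop :=
  f w != 0 /\ forall v, f v != 0 -> v = w \/ lt w v.

Definition fps_lin_indep (fs : seq fps) : Prop :=
  forall c : 'I_(size fs) -> K,
    (forall w, \sum_(k < size fs) c k * nth (fun _ => 0) fs k w = 0) ->
    forall k, c k = 0.

End Ops.

(* Main.v *)
Require Import Defs.
From HB Require Import structures.
From mathcomp Require Import all_boot all_order all_algebra.
From mathcomp Require Import fraction generic_quotient.
From mathcomp Require Import ring.
From mathcomp.multinomials Require Import ssrcomplements mpoly.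
From Stdlib Require Import IndefiniteDescription.

(** If every head coefficient is a unit at the origin, every [d^u] has a normal form modulo
    the ideal whose coefficients are regular at the origin. Taking the value at the origin
    of its coefficient at a parametric exponent [e], divided by [u!], as the coefficient of
    [x^u] gives a power series; it is a solution because [w!] times the coefficient of
    [x^w] in [g(f)] is the value at the origin of the [e]-coefficient of the normal form of
    [d^w g], which is [0].

    Conversely, let [g = h d^u + sum_v c_v d^v] with all [v] parametric. The matrix of the
    [d^v f_j] is triangular at the origin, so Cramer's rule makes [h] divide every [c_v] in
    the ring of power series (below: modulo every power of the maximal ideal, after
    multiplication by a polynomial that does not vanish at the origin). As [g] is
    primitive, its coefficients generate an ideal which contains, for every variable [x_i],
    a nonzero polynomial free of [x_i]. The least exponent of [h] divides that of all these
    polynomials, so it is [0], which means that [h] does not vanish at the origin. *)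

Set Implicit Arguments.
Unset Strict Implicit.
Unset Printing Implicit Defensive.

Import Order.TTheory GRing.Theory.
Local Open Scope ring_scope.

(** * GCD domains and Gauss's lemma *)

(** Over [kpoly] this is convertible with [pdvd], so the results below apply to [primitive] and
    [is_lcm] as they stand. *)
Definition rdvd (R : comNzRingType) (d a : R) : Prop := exists q, a = q * d.

Section Divisibility.
Variable R : comNzRingType.
Implicit Types a b c d : R.

Lemma rdvd_refl a : rdvd a a.
Proof. by exists 1; rewrite mul1r. Qed.

Lemma rdvd0 a : rdvd a 0.
Proof. by exists 0; rewrite mul0r. Qed.

Lemma rdvd1 a : rdvd 1 a.
Proof. by exists a; rewrite mulr1. Qed.

Lemma rdvd_trans b a c : rdvd a b -> rdvd b c -> rdvd a c.
Proof. by move=> [p ->] [q ->]; exists (q * p); rewrite mulrA. Qed.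

Lemma rdvd_mull a b c : rdvd a b -> rdvd a (c * b).
Proof. by move=> [p ->]; exists (c * p); rewrite mulrA. Qed.

Lemma rdvd_mulr a b c : rdvd a b -> rdvd a (b * c).
Proof. by rewrite mulrC; apply: rdvd_mull. Qed.

Lemma rdvdD a b c : rdvd a b -> rdvd a c -> rdvd a (b + c).
Proof. by move=> [p ->] [q ->]; exists (p + q); rewrite mulrDl. Qed.

Lemma rdvd_sum (I : Type) (s : seq I) (P : pred I) (F : I -> R) a :
  (forall i, P i -> rdvd a (F i)) -> rdvd a (\sum_(i <- s | P i) F i).
Proof. by move=> h; elim/big_ind: _ => //; [apply: rdvd0 | apply: rdvdD]. Qed.

Lemma rdvd_mul a b c d : rdvd a b -> rdvd c d -> rdvd (a * c) (b * d).
Proof. by move=> [p ->] [q ->]; exists (p * q); rewrite mulrACA. Qed.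

End Divisibility.

Lemma rdvd_mul2l (R : idomainType) (c a b : R) :
  c != 0 -> rdvd (c * a) (c * b) -> rdvd a b.
Proof.
move=> c0 [q e]; exists q; apply: (mulfI c0).
by rewrite e mulrCA.
Qed.

(** Universal property, fixing [d] up to associates; the empty sequence has gcd [0]. *)
Definition is_gcd (R : comNzRingType) (s : seq R) (d : R) : Prop :=
  forall e, (forall a, a \in s -> rdvd e a) <-> rdvd e d.

Definition has_gcd (R : comNzRingType) : Prop :=
  forall a b : R, exists d, is_gcd [:: a; b] d.

Lemma is_gcd_dvd (R : comNzRingType) (s : seq R) d a :
  is_gcd s d -> a \in s -> rdvd d a.
Proof. by move=> /(_ d) [_ h]; apply: h; apply: rdvd_refl. Qed.

Section Gcd.
Variable R : idomainType.
Hypothesis gcdR : has_gcd R.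

Lemma gcd_seq (s : seq R) : exists d, is_gcd s d.
Proof.
elim: s => [|a s [d hd]].
  by exists 0 => e; split=> // _; apply: rdvd0.
have [g hg] := gcdR a d; exists g => e; split=> [h|/hg h].
  apply/hg => x; rewrite !inE => /orP[] /eqP->; first by apply: h; rewrite mem_head.
  by apply/hd => y ys; apply: h; rewrite in_cons ys orbT.
move=> x; rewrite in_cons => /orP[/eqP->|]; first by apply: h; rewrite mem_head.
by apply: (hd e).2; apply: h; rewrite !inE eqxx orbT.
Qed.

(** A gcd [D] of the multiples exists and is divisible by [c]; cancelling [c] leaves a common
    divisor of [s], hence a divisor of [d]. *)
Lemma is_gcdM (s : seq R) (c d : R) :
  is_gcd s d -> is_gcd [seq c * a | a <- s] (c * d).
Proof.
move=> hd e; split; last first.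
  move=> h _ /mapP[a as_ ->]; apply: rdvd_trans h _.
  by apply: rdvd_mul; [apply: rdvd_refl | apply: is_gcd_dvd as_].
have [->|c0] := eqVneq c 0; first by rewrite mul0r => _; apply: rdvd0.
have [D hD] := gcd_seq [seq c * a | a <- s] => /hD eD.
have [D' eD'] : rdvd c D.
  by apply/hD => _ /mapP[a _ ->]; apply: rdvd_mulr; apply: rdvd_refl.
apply: rdvd_trans eD _; rewrite eD' mulrC; apply: rdvd_mul; first exact: rdvd_refl.
apply/hd => a as_; apply: (rdvd_mul2l c0); rewrite [c * D']mulrC -eD'.
by apply: is_gcd_dvd hD _; apply: map_f.
Qed.

Definition rcoprime (a b : R) := forall e, rdvd e a -> rdvd e b -> rdvd e 1.

(** Euclid's lemma: [c] is a gcd of [c * a] and [c * b], and [a] divides both. *)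
Lemma rcoprime_dvdM (a b c : R) :
  rcoprime a b -> rdvd a (b * c) -> rdvd a c.
Proof.
move=> co h; have g1 : is_gcd [:: a; b] 1.
  move=> e; split=> [he|e1 x _]; last by apply: rdvd_trans e1 _; apply: rdvd1.
  by apply: co; apply: he; rewrite !inE eqxx ?orbT.
have := is_gcdM c g1; rewrite mulr1 => /(_ a)[+ _]; apply.
move=> x; rewrite !inE => /orP[] /eqP->; last by rewrite mulrC.
by apply: rdvd_mull; apply: rdvd_refl.
Qed.

Definition prim_poly (f : {poly R}) := forall e, (forall i, rdvd e f`_i) -> rdvd e 1.

Lemma rdvd_coef (f : {poly R}) e :
  (forall i, rdvd e f`_i) <-> (forall a, a \in (f : seq R) -> rdvd e a).
Proof.
split=> [h a /(nthP 0)[i _ <-]|h i]; first exact: h.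
have [lt|le] := ltnP i (size f); first by apply: h; apply: mem_nth.
by rewrite nth_default //; apply: rdvd0.
Qed.

Lemma prim_content (f : {poly R}) c e :
  prim_poly f -> (forall i, rdvd e (c * f`_i)) -> rdvd e c.
Proof.
move=> pf h; have g1 : is_gcd f 1.
  move=> x; split=> [/rdvd_coef/pf//|x1 a _].
  by apply: rdvd_trans x1 _; apply: rdvd1.
have := is_gcdM c g1; rewrite mulr1 => /(_ e)[+ _]; apply.
by move=> _ /mapP[a /(nthP 0)[i _ <-] ->].
Qed.

Lemma content_decomp (f : {poly R}) :
  f != 0 -> exists c g, [/\ f = c *: g, c != 0 & prim_poly g].
Proof.
move=> f0; have [c hc] := gcd_seq f.
have cf : forall i, rdvd c f`_i.
  by apply/rdvd_coef => a; apply: is_gcd_dvd.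
have c0 : c != 0.
  apply/eqP => c0; have [q] := cf (size f).-1.
  by rewrite c0 mulr0 => /eqP; rewrite -lead_coefE lead_coef_eq0 (negbTE f0).
have [G hG] : exists G : seq R, map (fun x => x * c) G = f :> seq R.
  have : forall a, a \in (f : seq R) -> rdvd c a by move=> a; apply: is_gcd_dvd.
  elim: (f : seq R) => [_|a s IHs h]; first by exists [::].
  have [q qE] := h a (mem_head _ _).
  have [x xs|G GE] := IHs; first by apply: h; rewrite in_cons xs orbT.
  by exists (q :: G); rewrite /= GE -qE.
have fE : f = c *: Poly G.
  apply/polyP => i; rewrite coefZ coef_Poly -hG.
  have [lt|le] := ltnP i (size G); first by rewrite (nth_map 0) // mulrC.
  by rewrite !nth_default ?size_map // mulr0.
exists c, (Poly G); split=> // e he.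
apply: (rdvd_mul2l c0); rewrite mulr1; apply/hc/rdvd_coef => i.
by rewrite fE coefZ; apply: rdvd_mul; [apply: rdvd_refl | apply: he].
Qed.

(** Let [d] divide [c] and the leading coefficient. Removing the leading term leaves [k *: h] with
    [h] primitive and smaller, and [d] divides [k *: (h * g)]. As [h * g] is primitive, [d] divides
    [k], hence all coefficients of [f]. *)
Lemma prim_coprime_lead (f g : {poly R}) (c : R) :
  (forall k : {poly R}, (size k < size f)%N -> prim_poly k -> prim_poly (k * g)) ->
  prim_poly f -> (forall i, rdvd c (f * g)`_i) -> rcoprime c (lead_coef f).
Proof.
move=> IH pf hc d dc dl; apply: pf.
set t := lead_coef f *: 'X^((size f).-1).
have dt i : rdvd d t`_i by rewrite coefZ; apply: rdvd_mulr.
have [e|ft0] := eqVneq (f - t) 0.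
  by move=> i; rewrite -(subrK t f) e add0r.
have [k [h [ftE k0 ph]]] := content_decomp ft0.
have sz : (size h < size f)%N.
  have <- : size (f - t) = size h by rewrite ftE size_scale.
  have f0 : f != 0.
    apply/eqP=> f0; move: ft0.
    by rewrite /t f0 lead_coef0 scale0r subr0 eqxx.
  rewrite (leq_ltn_trans (n := (size f).-1)) // ?prednK ?size_poly_gt0 //.
  apply/leq_sizeP => j; rewrite leq_eqVlt => /orP[/eqP<-|lt].
    by rewrite coefB coefZ coefXn eqxx mulr1 subrr.
  rewrite coefB coefZ coefXn gtn_eqF // mulr0 subr0 nth_default //.
  by rewrite -(prednK (n := size f)) // size_poly_gt0.
have dk : rdvd d k.
  apply: (prim_content (IH h sz ph)) => i.
  rewrite -coefZ scalerAl -ftE mulrBl coefB; apply: rdvdD.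
    exact: rdvd_trans dc (hc i).
  rewrite -scalerAl coefZ -mulNr; apply: rdvd_mulr.
  by rewrite -mulN1r; apply: rdvd_mull.
move=> i; rewrite -(subrK t f) coefD ftE coefZ.
by apply: rdvdD => //; apply: rdvd_mulr.
Qed.

(** A common divisor [c] of the coefficients of [f * g] is coprime to both leading coefficients but
    divides their product, so it is a unit. *)
Lemma gauss (f g : {poly R}) : prim_poly f -> prim_poly g -> prim_poly (f * g).
Proof.
have [m] := ubnP (size f + size g); elim: m f g => // m IH f g le pf pg c hc.
have cof : rcoprime c (lead_coef f).
  apply: (@prim_coprime_lead f g) => // k lt pk; apply: IH => //.
  by move: le; rewrite ltnS; apply: leq_trans; rewrite ltn_add2r.
have cog : rcoprime c (lead_coef g).
  apply: (@prim_coprime_lead g f) => //; last by move=> i; rewrite mulrC.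
  move=> k lt pk; rewrite mulrC; apply: IH => //.
  by move: le; rewrite ltnS; apply: leq_trans; rewrite ltn_add2l.
apply: cog; first exact: rdvd_refl.
apply: (rcoprime_dvdM cof).
by rewrite -lead_coefM lead_coefE; apply: hc.
Qed.

(** In [l *: g = q * f], split off the contents of [q] and [g]. By Gauss's lemma the primitive part
    of [q] times [f] is primitive, so [l] times the content of [g] divides the content of [q], and
    [l] cancels. *)
Lemma rdvd_prim (f g : {poly R}) l :
  prim_poly f -> l != 0 -> rdvd f (l *: g) -> rdvd f g.
Proof.
move=> pf l0 [q e]; have [->|g0] := eqVneq g 0; first exact: rdvd0.
have q0 : q != 0.
  by apply: contra_neq g0 => q0; move/eqP: e; rewrite q0 mul0r scale_poly_eq0 (negbTE l0) => /eqP.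
have [k [q' [qE k0 pq]]] := content_decomp q0.
have [m [g' [gE m0 pg]]] := content_decomp g0.
have [x xE] : rdvd (l * m) k.
  apply: (prim_content (gauss pq pf)) => i.
  rewrite -coefZ scalerAl -qE -e gE scalerA coefZ.
  by apply: rdvd_mulr; apply: rdvd_refl.
exists ((x * m) *: q'); apply: (mulfI (x := l%:P)); rewrite ?polyC_eq0 // !mul_polyC.
by rewrite e qE xE -!scalerAl !scalerA; congr (_ *: _); rewrite mulrCA mulrA.
Qed.

(* A nonzero element of minimal degree of the ideal pseudo-divides all its elements;
   its primitive part then divides them outright. *)
Lemma ideal_prim_gen m (F : 'I_m -> {poly R}) : (exists k, F k != 0) ->
  exists (r : {poly R}) l A, [/\ prim_poly r, l != 0,
    forall k, rdvd r (F k) & l *: r = \sum_k A k * F k].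
Proof.
move=> [k0 F0]; have : exists2 r, r != 0 & exists A, r = \sum_k A k * F k.
  exists (F k0) => //; exists (fun k => (k == k0)%:R).
  rewrite (bigD1 k0) //= eqxx mul1r big1 ?addr0 // => k /negbTE->.
  by rewrite mul0r.
move=> [r r0 hA]; have [d] := ubnP (size r).
elim: d r r0 hA => // d IH r r0 [A rE] le.
have [/forallP h|] := boolP [forall k, F k %% r == 0].
  have [l [r' [r'E l0 pr]]] := content_decomp r0.
  exists r', l, A; split=> // [k|]; last by rewrite -r'E.
  apply: (@rdvd_prim _ _ (lead_coef r ^+ scalp (F k) r)) => //.
    by rewrite expf_neq0 // lead_coef_eq0.
  rewrite Pdiv.WeakIdomain.divp_eq (eqP (h k)) addr0 [X in _ * X]r'E -scalerAr scalerAl.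
  by apply: rdvd_mull; apply: rdvd_refl.
move/forallPn=> [k hk]; apply: (IH _ hk); last first.
  by move: le; rewrite ltnS; apply: leq_trans; rewrite ltn_modp.
exists (fun j => (j == k)%:R * (lead_coef r ^+ scalp (F k) r)%:P - (F k %/ r) * A j).
under eq_bigr do rewrite mulrBl.
rewrite sumrB (bigD1 k) //= eqxx mul1r [X in _ + X - _]big1; last first.
  by move=> j /negbTE->; rewrite !mul0r.
under eq_bigr do rewrite -mulrA.
rewrite -mulr_sumr -rE addr0 mul_polyC Pdiv.WeakIdomain.divp_eq.
by rewrite addrAC subrr add0r.
Qed.

(** The gcd is [d *: r], with [d] a gcd of the contents and [r] the primitive generator of the ideal
    over the fraction field. A common divisor splits likewise: its content divides both contents,
    and its primitive part divides [l *: r], hence [r]. *)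
Lemma has_gcd_poly : has_gcd {poly R}.
Proof.
move=> f g; have [->|f0] := eqVneq f 0.
  exists g => e; split=> [h|h x]; first by apply: h; rewrite !inE eqxx orbT.
  by rewrite !inE => /orP[] /eqP-> //; apply: rdvd0.
have [->|g0] := eqVneq g 0.
  exists f => e; split=> [h|h x]; first by apply: h; rewrite !inE eqxx.
  by rewrite !inE => /orP[] /eqP-> //; apply: rdvd0.
have [a [f' [fE a0 pf]]] := content_decomp f0.
have [b [g' [gE b0 pg]]] := content_decomp g0.
have [d hd] := gcdR a b.
pose F (i : 'I_2) := if i == 0 then f else g.
have [r [l [A [pr l0 rF rE]]]] : exists (r : {poly R}) l A, [/\ prim_poly r, l != 0,
    forall k, rdvd r (F k) & l *: r = \sum_k A k * F k].
  by apply: ideal_prim_gen; exists 0.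
have rf : rdvd r f' by apply: (rdvd_prim pr a0); rewrite -fE; apply: (rF 0).
have rg : rdvd r g' by apply: (rdvd_prim pr b0); rewrite -gE; apply: (rF 1).
have polyCdvd x y : rdvd x y -> rdvd x%:P y%:P by move=> [q ->]; exists q%:P; rewrite polyCM.
exists (d *: r) => e; split=> [h|h x]; last first.
  move=> xfg; apply: (rdvd_trans h); rewrite -mul_polyC.
  move: xfg; rewrite !inE => /orP[] /eqP->; rewrite ?fE ?gE -mul_polyC;
    apply: rdvd_mul => //; apply: polyCdvd; apply: (is_gcd_dvd hd); by rewrite !inE eqxx ?orbT.
have ef : rdvd e f by apply: h; rewrite mem_head.
have eg : rdvd e g by apply: h; rewrite !inE eqxx orbT.
have e0 : e != 0.
  by apply: contra_neq f0 => e0; have [q ->] := ef; rewrite e0 mulr0.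
have [m [e' [eE m0 pe]]] := content_decomp e0.
have mdvd c k : rdvd e (c *: k) -> prim_poly k -> rdvd m c.
  move=> [q qE] pk; apply: (prim_content pk) => i.
  rewrite -coefZ qE eE -scalerAr coefZ.
  by apply: rdvd_mulr; apply: rdvd_refl.
have e'e : rdvd e' e by rewrite eE -mul_polyC; apply: rdvd_mull; apply: rdvd_refl.
rewrite eE -!mul_polyC; apply: rdvd_mul.
  apply: polyCdvd; apply/hd => x; rewrite !inE => /orP[] /eqP->.
    by apply: (@mdvd _ f') => //; rewrite -fE.
  by apply: (@mdvd _ g') => //; rewrite -gE.
apply: (rdvd_prim pe l0); rewrite rE; apply: rdvd_sum => k _.
apply: rdvd_mull; apply: rdvd_trans e'e _.
by rewrite /F; case: ifP.
Qed.

End Gcd.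

(** Induction with [a L / gcd(a, L)] as the new lcm: here [a' * L], where [a = a' * d]. The
    cofactors [a'] and [L'] are coprime, so Euclid's lemma gives minimality. *)
Lemma has_lcm (R : idomainType) (s : seq R) : has_gcd R -> all (fun a => a != 0) s ->
  exists2 L, L != 0 & (forall h, h \in s -> rdvd h L) /\
    (forall M, (forall h, h \in s -> rdvd h M) -> rdvd L M).
Proof.
move=> gcdR; elim: s => [_|a s IHs /= /andP[a0 /IHs[L L0 [h1 h2]]]].
  exists 1; first exact: oner_neq0.
  by split=> // M _; apply: rdvd1.
have [d hd] := gcdR a L.
have [a' aE] : rdvd d a by apply: (is_gcd_dvd hd); rewrite mem_head.
have [L' LE] : rdvd d L by apply: (is_gcd_dvd hd); rewrite !inE eqxx orbT.
have d0 : d != 0 by apply: contra_neq a0 => d0; rewrite aE d0 mulr0.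
have a'0 : a' != 0 by apply: contra_neq a0 => e; rewrite aE e mul0r.
have L'0 : L' != 0 by apply: contra_neq L0 => e; rewrite LE e mul0r.
have co : rcoprime a' L'.
  move=> e ea eL; apply: (rdvd_mul2l d0); rewrite mulr1; apply/hd => x.
  rewrite !inE => /orP[] /eqP->; rewrite ?aE ?LE [_ * d]mulrC;
  by apply: rdvd_mul => //; apply: rdvd_refl.
exists (a' * L); first by rewrite mulf_neq0.
split=> [h|M hM].
  rewrite in_cons => /orP[/eqP->|/h1]; last exact: rdvd_mull.
  by rewrite aE LE mulrA mulrAC; apply: rdvd_mulr; apply: rdvd_refl.
have [y yE] : rdvd L M by apply: h2 => h hs; apply: hM; rewrite in_cons hs orbT.
have [x xE] : rdvd a M by apply: hM; rewrite mem_head.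
rewrite yE; apply: rdvd_mul; last exact: rdvd_refl.
apply: (rcoprime_dvdM gcdR co); exists x; apply: (mulfI d0).
move: xE; rewrite yE aE LE => e.
by rewrite mulrC [L' * y]mulrC -mulrA e mulrA mulrC.
Qed.

Lemma has_gcd_can (R S : comNzRingType) (f : {rmorphism R -> S}) (g : {rmorphism S -> R}) :
  cancel f g -> cancel g f -> has_gcd R -> has_gcd S.
Proof.
move=> fK gK gcdR a b; have [d hd] := gcdR (g a) (g b).
have dvdf x y : rdvd x y -> rdvd (f x) (f y) by move=> [q ->]; exists (f q); rewrite rmorphM.
have dvdg x y : rdvd x y -> rdvd (g x) (g y) by move=> [q ->]; exists (g q); rewrite rmorphM.
exists (f d) => e; split=> [h|h x].
  rewrite -(gK e); apply: dvdf; apply/hd => x.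
  by rewrite !inE => /orP[] /eqP->; apply: dvdg; apply: h; rewrite !inE eqxx ?orbT.
rewrite !inE => xab; apply: (rdvd_trans h); rewrite -(gK x); apply: dvdf.
by apply: (is_gcd_dvd hd); move: xab => /orP[] /eqP->; rewrite !inE eqxx ?orbT.
Qed.

(** * Polynomials in one distinguished variable *)

Lemma mpoly_rmorph_ext (K : fieldType) n (S : nzRingType)
    (f g : {rmorphism {mpoly K[n]} -> S}) :
  (forall c, f c%:MP = g c%:MP) -> (forall j, f 'X_j = g 'X_j) -> f =1 g.
Proof.
move=> fgC fgX p; rewrite (mpolyE p) (rmorph_sum f) (rmorph_sum g).
apply: eq_bigr => u _; rewrite -mul_mpolyC (rmorphM f) (rmorphM g) fgC; congr (_ * _).
rewrite mpolyXE_id (rmorph_prod f) (rmorph_prod g); apply: eq_bigr => j _.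
by rewrite (rmorphXn f) (rmorphXn g) fgX.
Qed.

Section Isolate.
Variables (K : fieldType) (n : nat) (i : 'I_n.+1).

(** The isomorphism with polynomials in ['X_i] over the ring in the other variables, renumbered by
    [unlift i]; [unisolate] is its inverse. *)
Definition isolate : {mpoly K[n.+1]} -> {poly {mpoly K[n]}} :=
  mmap (polyC \o @mpolyC n K)
       (fun j => if unlift i j is Some k then ('X_k)%:P else 'X).

Definition embed : {mpoly K[n]} -> {mpoly K[n.+1]} :=
  mmap (@mpolyC n.+1 K) (fun k => 'X_(lift i k)).

Definition unisolate (p : {poly {mpoly K[n]}}) : {mpoly K[n.+1]} :=
  (map_poly embed p).['X_i].

HB.instance Definition _ := GRing.RMorphism.on isolate.
HB.instance Definition _ := GRing.RMorphism.on embed.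
HB.instance Definition _ :=
  GRing.RMorphism.copy unisolate (horner_eval 'X_i \o map_poly embed).

Lemma unisolateC p : unisolate p%:P = embed p.
Proof. by rewrite /unisolate map_polyC hornerC. Qed.

Lemma isolateK : cancel isolate unisolate.
Proof.
apply: (@mpoly_rmorph_ext _ _ _ (unisolate \o isolate) idfun) => [c|j] /=.
  by rewrite /isolate mmapC /= unisolateC /embed mmapC.
rewrite /isolate mmapX mmap1U; case: unliftP => [k ->|->].
  by rewrite unisolateC /embed mmapX mmap1U.
by rewrite /unisolate map_polyX hornerX.
Qed.

Lemma isolate_embed p : isolate (embed p) = p%:P.
Proof.
apply: (@mpoly_rmorph_ext _ _ _ (isolate \o embed) polyC) => [c|j] /=.
  by rewrite /embed mmapC /isolate mmapC.
by rewrite /embed mmapX mmap1U /isolate mmapX mmap1U liftK.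
Qed.

Lemma unisolateK : cancel unisolate isolate.
Proof.
elim/poly_ind => [|p c IHp]; first by rewrite !rmorph0.
rewrite !rmorphD !rmorphM /= IHp unisolateC isolate_embed.
rewrite /unisolate map_polyX hornerX.
by rewrite /isolate mmapX mmap1U unlift_none.
Qed.

Lemma embed_msupp p m : m \in msupp (embed p) -> m i = 0%N.
Proof.
move=> /msupp_sum_le; rewrite filter_predT => /flattenP[_ /mapP[u _ ->]].
rewrite mul_mpolyC => /msuppZ_le.
rewrite /mmap1 mprodXnE => /mem_msuppXP <-.
rewrite mnm_sumE big1 // => j _; rewrite mulmnE mnm1E.
by rewrite eq_sym (negbTE (neq_lift _ _)).
Qed.

End Isolate.

(** Induction on the number of variables through [isolate]; without variables every nonzero
    polynomial is a constant, hence a unit. *)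
Lemma has_gcd_mpoly (K : fieldType) n : has_gcd {mpoly K[n]}.
Proof.
elim: n => [|n IHn]; last first.
  exact: (has_gcd_can (@unisolateK K n ord0) (@isolateK K n ord0) (has_gcd_poly IHn)).
have const (p : {mpoly K[0]}) : exists c, p = c%:MP.
  exists p@_0; apply/mpolyP => m; rewrite mcoeffC.
  by have -> : m = 0%MM; [apply/mnmP; case | rewrite eqxx mulr1].
have unit (p e : {mpoly K[0]}) : p != 0 -> rdvd p e.
  have [c ->] := const p; rewrite mpolyC_eq0 => c0; exists (e * (c^-1)%:MP).
  by rewrite -mulrA -mpolyCM mulVf // mpolyC1 mulr1.
move=> a b; have [->|a0] := eqVneq a 0; last first.
  exists 1 => e; split=> [h|h x _]; last by apply: rdvd_trans h _; apply: rdvd1.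
  by apply: (rdvd_trans (b := a)); [apply: h; rewrite mem_head | apply: unit].
exists b => e; split=> [h|h x]; first by apply: h; rewrite !inE eqxx orbT.
by rewrite !inE => /orP[] /eqP-> //; apply: rdvd0.
Qed.

(** Over the fraction field in the other variables, the ideal in ['X_i] is principal. Its primitive
    generator [r] divides every [F k], hence is a unit; so the multiple [l *: r], which lies in the
    ideal itself, is free of ['X_i]. *)
Lemma prim_elim_var (K : fieldType) n (i : 'I_n) m (F : 'I_m -> {mpoly K[n]}) :
  (exists k, F k != 0) -> (forall d, (forall k, rdvd d (F k)) -> rdvd d 1) ->
  exists (r : {mpoly K[n]}) A, [/\ r != 0, forall u, u \in msupp r -> u i = 0%N &
    r = \sum_k A k * F k].
Proof.
case: n i F => [[]//|n] i F [k0 Fk0] primF.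
have [r [l [A [pr l0 rF lrE]]]] :
    exists (r : {poly {mpoly K[n]}}) l A, [/\ prim_poly r, l != 0,
      forall k, rdvd r (isolate i (F k)) & l *: r = \sum_k A k * isolate i (F k)].
  apply: ideal_prim_gen; first exact: has_gcd_mpoly.
  by exists k0; rewrite -(rmorph0 (isolate i)) (can_eq (@isolateK K n i)).
have [q qE] : rdvd (unisolate i r) 1.
  apply: primF => k; have [q qE] := rF k; exists (unisolate i q).
  by rewrite -[LHS](@isolateK K n i) qE rmorphM.
have : size r == 1%N.
  have : size (isolate i q * r) == 1%N.
    by rewrite -[r in _ * r](@unisolateK K n i) -rmorphM -qE rmorph1 size_poly1.
  by rewrite size_mul_eq1 => /andP[].
case/size_poly1P => c c0 rE.
exists (embed i (l * c)), (fun k => unisolate i (A k)); split.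
- rewrite -(can_eq (@isolateK K n i)) rmorph0 isolate_embed.
  by rewrite polyC_eq0 mulf_neq0.
- by move=> u; apply: embed_msupp.
rewrite -unisolateC polyCM -rE mul_polyC lrE rmorph_sum /=.
by apply: eq_bigr => k _; rewrite rmorphM /= isolateK.
Qed.

(** * Least exponents and units at the origin *)

(** [mlast] is least for the canonical graded order on multinomials, not for [lt]. Any other pair
    with the same sum has a component below the least exponent of its factor, where the coefficient
    is zero. *)
Lemma mcoeff_mlastM (R : idomainType) n (p q : {mpoly R[n]}) :
  (p * q)@_(mlast p + mlast q) = p@_(mlast p) * q@_(mlast q).
Proof.
set a := mlast p; set b := mlast q.
have la : (mdeg a < (mdeg (a + b)).+1)%N by rewrite ltnS mdegD leq_addr.
have lb : (mdeg b < (mdeg (a + b)).+1)%N by rewrite ltnS mdegD leq_addl.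
rewrite mcoeffM (bigD1 (BMultinom la, BMultinom lb)) //= big1 ?addr0 //.
move=> [[u hu] [v hv]] /= /andP[/eqP e ne].
have [lt|le] := ltP u a; first by rewrite mcoeff_lt_mlast // mul0r.
have [lt|le'] := ltP v b; first by rewrite [q@_v]mcoeff_lt_mlast // mulr0.
case/negP: ne; rewrite xpair_eqE !eqE /=.
have ua : u = a.
  apply/eqP; rewrite eq_le le andbT leNgt; apply/negP => lt.
  by have := ltmc_le_add lt le'; rewrite -e ltxx.
by rewrite ua eqxx /=; move: e; rewrite ua => /addmI->.
Qed.

Lemma mlastM (R : idomainType) n (p q : {mpoly R[n]}) :
  p != 0 -> q != 0 -> mlast (p * q) = (mlast p + mlast q)%MM.
Proof.
move=> p0 q0; apply: mlastE.
  rewrite mcoeff_msupp mcoeff_mlastM mulf_neq0 // -mcoeff_msupp;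
  exact: mlast_supp.
move=> m /msuppM_le /allpairsP[[u v] /= [us vs ->]].
by apply: lem_add; apply: mlast_lemc.
Qed.

Lemma mlast_eq0 (R : nzRingType) n (p : {mpoly R[n]}) : p@_0 != 0 -> mlast p = 0%MM.
Proof. by move=> h; apply: mlastE; rewrite ?mcoeff_msupp // => m _; apply: le0m. Qed.

(* The least exponent of the multiple [h * s] is that of [r], which by [prim_elim_var]
   may be taken free of any prescribed variable; so no variable occurs in that of [h]. *)
Lemma congr_prim_unit (K : fieldType) n m (h : {mpoly K[n]}) (F : 'I_m -> {mpoly K[n]}) :
  h != 0 -> (exists k, F k != 0) ->
  (forall d, (forall k, rdvd d (F k)) -> rdvd d 1) ->
  (forall N, exists2 delta : {mpoly K[n]}, delta@_0 != 0 &
     forall k, exists s, forall w, (mdeg w < N)%N -> (delta * F k - h * s)@_w = 0) ->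
  h@_0 != 0.
Proof.
move=> h0 Fn0 primF congrF.
suff <- : mlast h = 0%MM by rewrite -mcoeff_msupp mlast_supp.
apply/mnmP => i; rewrite mnm0E.
have [r [A [r0 ri rE]]] := prim_elim_var i Fn0 primF.
(* This precision covers the degree of [mlast r], so the least term of [d * r] survives in
   [h * s]. *)
have [d d0 dF] := congrF (mdeg (mlast r)).+1.
have [s sE] : exists s, forall w, (mdeg w < (mdeg (mlast r)).+1)%N -> (d * r - h * s)@_w = 0.
  have [s hs] := functional_choice _ dF.
  exists (\sum_k A k * s k) => w hw.
  have -> : d * r - h * \sum_k A k * s k = \sum_k A k * (d * F k - h * s k).
    rewrite rE !mulr_sumr -sumrB; apply: eq_bigr => k _.
    by rewrite mulrBr !(mulrCA (A k)).
  rewrite raddf_sum big1 //= => k _; rewrite mcoeffM big1 // => -[u v] /= /eqP wE.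
  rewrite (hs k v) ?mulr0 //; apply: leq_ltn_trans hw.
  by rewrite [X in (_ <= mdeg X)%N]wE mdegD leq_addl.
have dn0 : d != 0 by apply: contra_neq d0 => ->; rewrite mcoeff0.
have lastdr : mlast (d * r) = mlast r by rewrite mlastM // mlast_eq0 // add0m.
have coefE w : (mdeg w <= mdeg (mlast r))%N -> (h * s)@_w = (d * r)@_w.
  by rewrite -ltnS => /sE/eqP; rewrite mcoeffB subr_eq0 => /eqP.
have hs0 : (h * s)@_(mlast r) != 0.
  rewrite coefE // -lastdr -mcoeff_msupp; apply: mlast_supp.
  exact: mulf_neq0.
have lasths : mlast (h * s) = mlast r.
  apply: mlastE; first by rewrite mcoeff_msupp.
  move=> u us; have [le|lt] := leqP (mdeg u) (mdeg (mlast r)); last exact/ltW/lt_mdeg_ltmc.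
  by rewrite -lastdr; apply: mlast_lemc; rewrite mcoeff_msupp -coefE // -mcoeff_msupp.
have s0 : s != 0 by apply: contra_neq hs0 => ->; rewrite mulr0 mcoeff0.
have := ri _ (mlast_supp r0); rewrite -lasths mlastM // mnmDE => /eqP.
by rewrite addn_eq0 => /andP[/eqP].
Qed.

(** * Graded orders and head terms *)

Lemma mdeg_lem_eq n (u v : 'X_{1..n}) : (u <= v)%MM -> u != v -> (mdeg u < mdeg v)%N.
Proof.
move=> le ne; rewrite -(submK le) mdegD -[X in (X < _)%N]add0n ltn_add2r lt0n mdeg_eq0.
by apply: contra_neq ne => e; rewrite -(submK le) e add0m.
Qed.

Section Order.
Variables (n : nat) (lt : rel 'X_{1..n}).
Hypothesis lt_order : graded_term_order lt.

Let lt_irr : irreflexive lt := let: And5 h _ _ _ _ := lt_order in h.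
Let lt_trans : transitive lt := let: And5 _ h _ _ _ := lt_order in h.
Let lt_total u v : u != v -> lt u v || lt v u := let: And5 _ _ h _ _ := lt_order in h u v.
Let lt_add u v w : lt u v -> lt (u + w)%MM (v + w)%MM :=
  let: And5 _ _ _ h _ := lt_order in h u v w.
Let lt_mdeg u v : (mdeg u < mdeg v)%N -> lt u v := let: And5 _ _ _ _ h := lt_order in h u v.

Definition lte u v := (u == v) || lt u v.

Lemma lte_refl u : lte u u. Proof. by rewrite /lte eqxx. Qed.

Lemma lte_trans v u w : lte u v -> lte v w -> lte u w.
Proof.
rewrite /lte => /orP[/eqP->//|uv] /orP[/eqP<-|vw]; first by rewrite uv orbT.
by rewrite (lt_trans uv vw) orbT.
Qed.

Lemma lt_lte_trans v u w : lt u v -> lte v w -> lt u w.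
Proof. by move=> uv /orP[/eqP<-//|]; apply: lt_trans. Qed.

Lemma lteNlt u v : lte u v -> ~~ lt v u.
Proof.
by move=> uv; apply/negP => vu; have := lt_lte_trans vu uv; rewrite lt_irr.
Qed.

Lemma lte_mdeg u v : lte u v -> (mdeg u <= mdeg v)%N.
Proof. by move=> /lteNlt; rewrite leqNgt; apply: contra; apply: lt_mdeg. Qed.

Lemma lte_add u v u' v' : lte u u' -> lte v v' -> lte (u + v)%MM (u' + v')%MM.
Proof.
move=> uu vv; apply: (@lte_trans (u' + v)%MM).
  by move: uu; rewrite /lte => /orP[/eqP->|/(lt_add v)->]; rewrite ?eqxx ?orbT.
by move: vv; rewrite /lte ![(u' + _)%MM]addmC => /orP[/eqP->|/(lt_add u')->]; rewrite ?eqxx ?orbT.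
Qed.

Lemma lem_lte u v : (u <= v)%MM -> lte u v.
Proof.
move=> le; rewrite /lte; have [->//|ne] /= := eqVneq u v.
exact/lt_mdeg/mdeg_lem_eq.
Qed.

(** A graded order has finitely many exponents below [u]; induct on their number, within a fixed
    degree bound [N]. *)
Lemma graded_ind (P : 'X_{1..n} -> Prop) :
  (forall u, (forall v, lt v u -> P v) -> P u) -> forall u, P u.
Proof.
move=> IH u; have [N] : exists N, (mdeg u < N)%N by exists (mdeg u).+1.
pose c v := #|[set x : 'X_{1..n < N} | lt x v]|.
have [m] := ubnP (c u); elim: m u => // m IHm u cu uN.
apply: IH => v vu.
have vN : (mdeg v < N)%N.
  by apply: leq_ltn_trans uN; apply: lte_mdeg; rewrite /lte vu orbT.
apply: IHm => //; move: cu; rewrite ltnS; apply: leq_trans.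
apply: proper_card; apply/properP; split.
  by apply/subsetP => x; rewrite !inE => /lt_trans; apply.
by exists (BMultinom vN); rewrite !inE ?lt_irr.
Qed.

(** Any starting value is allowed, so that this serves both [lt_max] and the choice of a largest
    exponent in the determinant argument. *)
Lemma lt_max_spec (x : 'X_{1..n}) s :
  let m := foldr (fun u acc => if lt acc u then u else acc) x s in
  m \in x :: s /\ forall u, u \in x :: s -> lte u m.
Proof.
elim: s => [|a s [mem max]] /=.
  by split=> [|u]; rewrite inE // => /eqP->; apply: lte_refl.
move: mem max; set m := foldr _ _ _ => mem max.
have tot : lt m a \/ lte a m.
  have [->|/lt_total/orP[am|ma]] := eqVneq a m; first by right; apply: lte_refl.
    by right; rewrite /lte am orbT.
  by left.
case: ifP => ma; split=> [|u].
- by rewrite !inE eqxx orbT.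
- rewrite !inE orbCA => /orP[/eqP->|us]; first exact: lte_refl.
  by apply: (@lte_trans m); [apply: max; rewrite inE | rewrite /lte ma orbT].
- by move: mem; rewrite !inE => /orP[->//|->]; rewrite !orbT.
rewrite !inE orbCA => /orP[/eqP->|us]; last by apply: max; rewrite inE.
by case: tot => //; rewrite ma.
Qed.

Section Head.
Variable R : nzRingType.
Implicit Types P : {mpoly R[n]}.

Lemma head_term_supp P : P != 0 -> head_term lt P \in msupp P.
Proof.
rewrite -msupp_eq0 /head_term /lt_max; case: (msupp P) => // a s _.
by have [] := lt_max_spec a (a :: s); rewrite !inE orbA orbb.
Qed.

Lemma head_term_max P u : u \in msupp P -> lte u (head_term lt P).
Proof.
rewrite /head_term /lt_max; case: (msupp P) => // a s us.
by have [_] := lt_max_spec a (a :: s); apply; rewrite inE us orbT.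
Qed.

End Head.
End Order.

(** * The left ideal *)

(** A common index set lets sums over different supports be compared. *)
Lemma big_msupp (R : nzRingType) n (V : nmodType) (F : 'X_{1..n} -> R -> V) (p : {mpoly R[n]}) k :
  (forall u, F u 0 = 0) -> (msize p <= k)%N ->
  \sum_(u <- msupp p) F u p@_u = \sum_(u : 'X_{1..n < k}) F u p@_u.
Proof.
move=> F0 le; rewrite (big_mksub 'X_{1..n < k}) ?msupp_uniq //=; first last.
  by move=> x /msize_mdeg_lt /leq_trans; apply.
rewrite [RHS](bigID (fun u : 'X_{1..n < k} => (u : 'X_{1..n}) \in msupp p)) /=.
by rewrite [X in _ = _ + X]big1 ?addr0 // => u /memN_msupp_eq0 ->.
Qed.

Section SumSupport.
Variables (R : nzRingType) (n : nat) (V : nmodType) (F : 'X_{1..n} -> R -> V).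
Hypothesis F0 : forall u, F u 0 = 0.
Hypothesis FD : forall u, {morph F u : a b / a + b}.

Lemma sum_msuppD p q : \sum_(u <- msupp (p + q)) F u (p + q)@_u =
  \sum_(u <- msupp p) F u p@_u + \sum_(u <- msupp q) F u q@_u.
Proof.
pose k := maxn (msize (p + q)) (maxn (msize p) (msize q)).
rewrite !(big_msupp (k := k)) ?leq_max ?leqnn ?orbT //.
by rewrite -big_split; apply: eq_bigr => u _; rewrite mcoeffD FD.
Qed.

Lemma sum_msupp0 : \sum_(u <- msupp (0 : {mpoly R[n]})) F u (0 : {mpoly R[n]})@_u = 0.
Proof. by rewrite (_ : msupp 0 = [::]) ?big_nil //; apply/eqP; rewrite msupp_eq0. Qed.

Lemma sum_msupp_sum (I : Type) (s : seq I) (Q : pred I) (p : I -> {mpoly R[n]}) :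
  \sum_(u <- msupp (\sum_(i <- s | Q i) p i)) F u (\sum_(i <- s | Q i) p i)@_u =
  \sum_(i <- s | Q i) \sum_(u <- msupp (p i)) F u (p i)@_u.
Proof.
exact: (big_morph (fun p => \sum_(u <- msupp p) F u p@_u) sum_msuppD sum_msupp0).
Qed.

Lemma sum_msuppZX c v : \sum_(u <- msupp (c *: 'X_[v])) F u (c *: 'X_[v])@_u = F v c.
Proof.
have [->|c0] := eqVneq c 0; first by rewrite scale0r sum_msupp0 F0.
by rewrite msuppMCX // big_seq1 mcoeffZ mcoeffX eqxx mulr1.
Qed.

End SumSupport.

Section RopMul.
Variables (K : fieldType) (n : nat).
Implicit Types P Q : rop K n.

(** The product of [a d^u] with [Q]. It is linear in [a], whence the product of operators is linear
    in its left factor and left ideals are subspaces. *)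
Definition rop_term Q (u : 'X_{1..n}) (a : kfrac K n) : rop K n :=
  \sum_(v <- msupp Q) \sum_(w : 'X_{1..n < (mdeg u).+1} | (bmnm w <= u)%MM)
    ((a * (mbinom u w)%:R * fderivm w (Q@_v)) *: 'X_[(u - w + v)%MM]).

Lemma rop_mulE P Q : rop_mul P Q = \sum_(u <- msupp P) rop_term Q u P@_u.
Proof. by []. Qed.

Lemma rop_term0 Q u : rop_term Q u 0 = 0.
Proof. by rewrite /rop_term big1 // => v _; rewrite big1 // => w _; rewrite !mul0r scale0r. Qed.

Lemma rop_termD Q u : {morph rop_term Q u : a b / a + b}.
Proof.
move=> a b; rewrite -big_split; apply: eq_bigr => v _.
by rewrite -big_split; apply: eq_bigr => w _ /=; rewrite -scalerDl !mulrDl.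
Qed.

Lemma rop_termZ Q u c a : rop_term Q u (c * a) = c *: rop_term Q u a.
Proof.
rewrite scaler_sumr; apply: eq_bigr => v _.
by rewrite scaler_sumr; apply: eq_bigr => w _; rewrite scalerA !mulrA.
Qed.

Lemma rop_mul0 Q : rop_mul 0 Q = 0.
Proof. by rewrite rop_mulE sum_msupp0. Qed.

Lemma rop_mulD P1 P2 Q : rop_mul (P1 + P2) Q = rop_mul P1 Q + rop_mul P2 Q.
Proof. by rewrite !rop_mulE sum_msuppD //; [apply: rop_term0 | apply: rop_termD]. Qed.

Lemma rop_mulZ c P Q : rop_mul (c *: P) Q = c *: rop_mul P Q.
Proof.
pose k := maxn (msize (c *: P)) (msize P).
rewrite !rop_mulE !(big_msupp (k := k)) ?leq_max ?leqnn ?orbT //; try exact: rop_term0.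
by rewrite scaler_sumr; apply: eq_bigr => u _; rewrite mcoeffZ rop_termZ.
Qed.

Variable G : seq (rop K n).

Lemma left_idealD P Q : left_ideal G P -> left_ideal G Q -> left_ideal G (P + Q).
Proof.
move=> [A ->] [B ->]; exists (fun k => A k + B k).
by rewrite -big_split; apply: eq_bigr => k _; rewrite rop_mulD.
Qed.

Lemma left_idealZ c P : left_ideal G P -> left_ideal G (c *: P).
Proof.
move=> [A ->]; exists (fun k => c *: A k).
by rewrite scaler_sumr; apply: eq_bigr => k _; rewrite rop_mulZ.
Qed.

Lemma left_ideal0 : left_ideal G 0.
Proof. by exists (fun=> 0); rewrite big1 // => k _; rewrite rop_mul0. Qed.

Lemma left_ideal_sum (I : Type) (s : seq I) (F : I -> rop K n) :
  (forall i, left_ideal G (F i)) -> left_ideal G (\sum_(i <- s) F i).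
Proof.
move=> h; elim/big_ind: _ => //; [exact: left_ideal0 | exact: left_idealD].
Qed.

Lemma left_ideal_mul P g : g \in G -> left_ideal G (rop_mul P g).
Proof.
move=> gG; have lt : (index g G < size G)%N by rewrite index_mem.
exists (fun k => if k == Ordinal lt then P else 0).
rewrite (bigD1 (Ordinal lt)) //= eqxx nth_index // big1 ?addr0 // => k /negbTE->.
exact: rop_mul0.
Qed.

End RopMul.

(** * Left multiplication by derivations *)

Section Deriv.
Variables (K : fieldType) (n : nat).
Local Notation tofrac := (@FracField.tofrac (kpoly K n)).

(** The chosen representative [num / den] of [tofrac p] is only known to satisfy [p den = num]; the
    quotient rule then has numerator [p' den^2]. *)
Lemma fderiv_tofrac i (p : kpoly K n) : fderiv i (tofrac p) = tofrac p^`M(i).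
Proof.
rewrite /fderiv; set x := repr _.
have q0 : \d_x != 0 by apply: denom_ratioP.
have pE : p * \d_x = \n_x.
  have := FracField.equivf_r (Ratio p 1).
  by rewrite !numden_Ratio ?oner_eq0 // mul1r /x /FracField.tofrac -lock.
rewrite [X in tofrac X / _](_ : _ = p^`M(i) * (\d_x * \d_x)); last first.
  by rewrite -pE mderivM mulrDl -!mulrA (mulrC \d_x^`M(i)) addrK.
by rewrite tofracM mulfK // tofrac_eq0 mulf_neq0.
Qed.

Lemma fderivm_tofrac w (p : kpoly K n) : fderivm w (tofrac p) = tofrac p^`M[w].
Proof.
rewrite /fderivm /mderivm; elim: (enum _) => //= i s ->.
by elim: (w i) => //= k ->; rewrite fderiv_tofrac.
Qed.

Lemma pop_to_rop_coef (P : pop K n) u : (pop_to_rop P)@_u = tofrac P@_u.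
Proof. exact: mcoeff_map_mpoly. Qed.

Lemma pop_to_rop_msupp (P : pop K n) : perm_eq (msupp (pop_to_rop P)) (msupp P).
Proof.
apply: uniq_perm; rewrite ?msupp_uniq // => u.
by rewrite !mcoeff_msupp pop_to_rop_coef tofrac_eq0.
Qed.

Lemma pop_to_ropD (P Q : pop K n) : pop_to_rop (P + Q) = pop_to_rop P + pop_to_rop Q.
Proof. exact: rmorphD. Qed.

Lemma pop_to_rop_sum (I : Type) (s : seq I) (P : pred I) (F : I -> pop K n) :
  pop_to_rop (\sum_(i <- s | P i) F i) = \sum_(i <- s | P i) pop_to_rop (F i).
Proof. exact: rmorph_sum. Qed.

Lemma pop_to_ropZ c (P : pop K n) : pop_to_rop (c *: P) = tofrac c *: pop_to_rop P.
Proof. apply/mpolyP => u; rewrite [RHS]mcoeffZ [in RHS]pop_to_rop_coef.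
by rewrite [LHS]pop_to_rop_coef [(c *: P)@_u]mcoeffZ tofracM. Qed.

Lemma pop_to_ropX u : pop_to_rop ('X_[u] : pop K n) = 'X_[u].
Proof. by apply/mpolyP => v; rewrite pop_to_rop_coef !mcoeffX rmorph_nat. Qed.

(** Leibniz rule for [d^w (c d^v)]; the coefficients remain polynomials, so that they have values at
    the origin. *)
Definition deriv_mul_term (w v : 'X_{1..n}) (c : kpoly K n) : pop K n :=
  \sum_(w' : 'X_{1..n < (mdeg w).+1} | (bmnm w' <= w)%MM)
     ((mbinom w w')%:R * c^`M[w']) *: 'X_[(w - w' + v)%MM].

Lemma deriv_mul_termE w v c u : (deriv_mul_term w v c)@_u =
  \sum_(w' : 'X_{1..n < (mdeg w).+1} | (bmnm w' <= w)%MM)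
     ((mbinom w w')%:R * c^`M[w']) * ((w - w' + v)%MM == u)%:R.
Proof.
rewrite /deriv_mul_term raddf_sum /=; apply: eq_bigr => w' _.
by rewrite mcoeffZ mcoeffX.
Qed.

Definition deriv_mul (w : 'X_{1..n}) (g : pop K n) : pop K n :=
  \sum_(v <- msupp g) deriv_mul_term w v g@_v.

Lemma rop_mul_deriv w (g : pop K n) :
  rop_mul 'X_[w] (pop_to_rop g) = pop_to_rop (deriv_mul w g).
Proof.
rewrite rop_mulE msuppX big_seq1 mcoeffX eqxx /rop_term.
rewrite (perm_big _ (pop_to_rop_msupp g)) pop_to_rop_sum.
apply: eq_bigr => v _; rewrite pop_to_rop_sum; apply: eq_bigr => w' _.
rewrite pop_to_ropZ pop_to_ropX pop_to_rop_coef.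
by rewrite fderivm_tofrac mul1r tofracM rmorph_nat.
Qed.

Lemma deriv_mul_supp_lte lt w (g : pop K n) u : graded_term_order lt ->
  u \in msupp (deriv_mul w g) -> lte lt u (w + head_term lt g)%MM.
Proof.
move=> lto /msupp_sum_le; rewrite filter_predT => /flattenP[_ /mapP[v vg ->]].
move/msupp_sum_le => /flattenP[_ /mapP[w' _ ->]] /msuppZ_le /mem_msuppXP <-.
apply: lte_add => //; last exact: head_term_max.
by apply: lem_lte => //; apply: lem_subr.
Qed.

(** A degree count shows that only [w' = 0] and [v] the head exponent reach [w + head_term lt g]:
    differentiating a coefficient lowers the degree in [d]. *)
Lemma deriv_mul_head lt w (g : pop K n) : graded_term_order lt -> g != 0 ->
  (deriv_mul w g)@_(w + head_term lt g) = head_coef lt g.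
Proof.
move=> lto g0; rewrite raddf_sum (bigD1_seq (head_term lt g)) ?msupp_uniq ?head_term_supp //=.
have w0 : (mdeg (0%MM : 'X_{1..n}) < (mdeg w).+1)%N by rewrite mdeg0.
have w'0 (w' : 'X_{1..n < (mdeg w).+1}) v : (w' <= w)%MM -> lte lt v (head_term lt g) ->
    (w - w' + v == w + head_term lt g)%MM -> w' = BMultinom w0 /\ v = head_term lt g.
  move=> le lev /eqP e; suff z : bmnm w' = 0%MM.
    by split; [apply: val_inj | move: e; rewrite z subm0 => /addmI].
  apply/eqP; rewrite -mdeg_eq0 -leqn0; have := lte_mdeg lto lev.
  have : mdeg (w - w' + v)%MM = mdeg (w + head_term lt g)%MM by rewrite e.
  rewrite -[in RHS](submK le) !mdegD -addnA => /addnI ->.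
  by rewrite -[X in (_ <= X)%N]add0n leq_add2r.
rewrite [X in _ + X]big_seq_cond [X in _ + X]big1 ?addr0 => [|v /andP[vg vne]]; last first.
  rewrite deriv_mul_termE big1 // => w' le.
  case: eqVneq => [/eqP|_]; last by rewrite mulr0.
  by move/(w'0 _ _ le (head_term_max lto vg)) => [_ vE]; rewrite vE eqxx in vne.
rewrite deriv_mul_termE (bigD1 (BMultinom w0)) //=; last by apply/mnm_lepP => i; rewrite mnm0E.
rewrite big1 ?addr0 => [|w' /andP[le ne]].
  rewrite subm0 eqxx mulr1 mderivm0m /mbinom big1 ?mul1r // => i _.
  by rewrite mnm0E bin0.
case: eqVneq => [/eqP|_]; last by rewrite mulr0.
by move/(w'0 _ _ le (lte_refl _ _)) => [wE _]; rewrite wE eqxx in ne.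
Qed.

End Deriv.

(** * Parametric exponents and normal forms *)

Section Ideal.
Variables (K : fieldType) (n : nat) (lt : rel 'X_{1..n}) (G : seq (pop K n)).
Hypothesis lt_order : graded_term_order lt.
Hypothesis gbG : groebner_basis lt G.
Implicit Types P Q : pop K n.

Let ideal := left_ideal (map (@pop_to_rop K n) G).

Definition in_ideal P := ideal (pop_to_rop P).

Lemma in_idealD P Q : in_ideal P -> in_ideal Q -> in_ideal (P + Q).
Proof. by rewrite /in_ideal pop_to_ropD; apply: left_idealD. Qed.

Lemma in_idealZ c P : in_ideal P -> in_ideal (c *: P).
Proof. by rewrite /in_ideal pop_to_ropZ; apply: left_idealZ. Qed.

Lemma in_idealB P Q : in_ideal P -> in_ideal Q -> in_ideal (P - Q).
Proof. by move=> hP /(in_idealZ (-1)); rewrite scaleN1r; apply: in_idealD. Qed.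

Lemma in_ideal0 : in_ideal 0.
Proof. by rewrite /in_ideal /pop_to_rop rmorph0; apply: left_ideal0. Qed.

Lemma in_ideal_deriv_mul w g : g \in G -> in_ideal (deriv_mul w g).
Proof. by move=> gG; rewrite /in_ideal -rop_mul_deriv; apply/left_ideal_mul/map_f. Qed.

Definition param u := all (fun g => ~~ (head_term lt g <= u)%MM) G.

Lemma paramP u : reflect (param_exp lt G u) (param u).
Proof. exact: allP. Qed.

(** Parametric terms are independent modulo the ideal: the head of a nonzero ideal element is
    divisible by a head term of [G]. *)
Lemma ideal_param_eq0 (P : rop K n) : ideal P -> (forall u, u \in msupp P -> param u) -> P = 0.
Proof.
move=> IP hP; apply/eqP; apply: contraT => P0.
have [g gG] := gbG.2 P IP P0.
by rewrite (negbTE (paramP _ (hP _ (head_term_supp lt_order P0)) _ gG)).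
Qed.

Lemma in_ideal_param_eq0 P : in_ideal P -> (forall u, u \in msupp P -> param u) -> P = 0.
Proof.
move=> IP hP; have z : pop_to_rop P = 0.
  by apply: ideal_param_eq0 => // u; rewrite (perm_mem (pop_to_rop_msupp P)); apply: hP.
apply/eqP; rewrite -msupp_eq0 -size_eq0 -(perm_size (pop_to_rop_msupp P)) z.
by rewrite size_eq0 msupp_eq0.
Qed.

(** The coordinates of more than [size B] parametric terms satisfy a nonzero relation [y], which
    would give a nonzero ideal element with parametric support. *)
Lemma param_bound (B : seq (rop K n)) (s : seq 'X_{1..n}) :
  (forall P : rop K n, exists c : 'I_(size B) -> kfrac K n,
     ideal (P - \sum_(k < size B) c k *: nth 0 B k)) ->
  uniq s -> all param s -> (size s <= size B)%N.
Proof.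
move=> hB us ps; rewrite leqNgt; apply/negP => lt_size.
have [c hc] := functional_choice _ (fun j : 'I_(size s) => hB 'X_[nth 0%MM s j]).
pose C := \matrix_(j, k) c j k.
have : kermx C != 0.
  rewrite kermx_eq0 /row_free; apply/negP => /eqP e.
  by have := rank_leq_col C; rewrite e leqNgt lt_size.
case/rowV0Pn => y /sub_kermxP yC; case/rV0Pn => j0 /negP[].
pose P : rop K n := \sum_j y 0 j *: 'X_[nth 0%MM s j].
have PE u : P@_u = \sum_j y 0 j * (nth 0%MM s j == u)%:R.
  by rewrite raddf_sum; apply: eq_bigr => j _ /=; rewrite mcoeffZ mcoeffX.
have IP : ideal P.
  suff -> : P = \sum_j y 0 j *: ('X_[nth 0%MM s j] - \sum_k c j k *: nth 0 B k).
    by apply: left_ideal_sum => j; apply: left_idealZ; apply: hc.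
  under [RHS]eq_bigr do rewrite scalerBr scaler_sumr.
  rewrite sumrB exchange_big /= [X in _ - X]big1 ?subr0 // => k _.
  under eq_bigr do rewrite scalerA.
  rewrite -scaler_suml; have := congr1 (fun A : 'M__ => A 0 k) yC.
  by rewrite !mxE => e; under eq_bigr do rewrite -[c _ _](mxE matrix_key); rewrite e scale0r.
have P0 : P = 0.
  apply: ideal_param_eq0 => // u; rewrite mcoeff_msupp PE => nz.
  suff /(allP ps) : u \in s by [].
  apply: contraNT nz => us'; rewrite big1 // => j _.
  by case: eqP => [e|_]; rewrite ?mulr0 //; rewrite -e mem_nth in us'.
have := PE (nth 0%MM s j0); rewrite P0 mcoeff0 (bigD1 j0) //= eqxx mulr1.
rewrite big1 ?addr0 => [->//|j ne].
by rewrite nth_uniq // (negbTE (_ : val j != val j0)) ?mulr0.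
Qed.

(** The divisors of a parametric exponent are parametric as well, so with [param_bound] this chain
    limits its degree; only finitely many are left. *)
Lemma lem_chain m (u : 'X_{1..n}) : mdeg u = m -> exists s : seq 'X_{1..n},
  [/\ size s = m.+1, uniq s & all (fun v => v <= u)%MM s].
Proof.
elim: m u => [|m IHm] u um; first by exists [:: u]; rewrite /= lepm_refl.
have [i ui] : exists i, u i != 0%N.
  apply/existsP; rewrite -[X in is_true X]negbK negb_exists; apply/negP => /forallP h.
  have /eqP : mdeg u = 0%N.
    by rewrite mdegE big1 // => i _; have := h i; rewrite negbK => /eqP.
  by rewrite um.
have le : (U_(i) <= u)%MM by rewrite lep1mP.
have um' : mdeg (u - U_(i))%MM = m.
  by have := mdegD (u - U_(i))%MM U_(i)%MM; rewrite submK // um mdeg1 addn1 => -[].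
have [s [ss us hs]] := IHm _ um'; exists (u :: s); split; rewrite /= ?ss //.
  rewrite us andbT; apply/negP => /(allP hs) /mnm_lepP /(_ i).
  by rewrite mnmBE mnm1E eqxx -ltnS; case: (u i) ui => //= k _; rewrite subn1 /= ltnn.
rewrite lepm_refl /=; apply: sub_all hs => v hv.
exact: lepm_trans hv (lem_subr _ _).
Qed.

Lemma param_lem u v : (v <= u)%MM -> param u -> param v.
Proof.
move=> le /allP pu; apply/allP => g /pu; apply: contra => h.
exact: lepm_trans h le.
Qed.

Lemma D_finite_param : D_finite (map (@pop_to_rop K n) G) ->
  exists es, uniq es /\ (forall u, u \in es = param u).
Proof.
move=> [B hB].
exists [seq val v | v <- enum {: 'X_{1..n < size B}} & param (val v)].
split=> [|u]; first by rewrite map_inj_uniq ?filter_uniq -?enumT ?enum_uniq // => x y /val_inj.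
apply/mapP/idP => [[v]|pu]; first by rewrite mem_filter => /andP[pv _] ->.
have uB : (mdeg u < size B)%N.
  have [s [<- us hs]] := lem_chain (erefl (mdeg u)).
  by apply: param_bound hB us _; apply: sub_all hs => v vu; apply: param_lem pu.
by exists (BMultinom uB); rewrite // mem_filter pu mem_enum.
Qed.

(* [P] has a normal form modulo the ideal whose denominators do not vanish at the origin
   and whose exponents are bounded by [b]. *)
Definition reducible b P := exists q p, [/\ q@_0 != 0,
  forall u, u \in msupp p -> param u /\ lte lt u b & in_ideal (q *: P - p)].

Lemma mul_coef0_neq0 (q q' : kpoly K n) : q@_0 != 0 -> q'@_0 != 0 -> (q * q')@_0 != 0.
Proof. by move=> h h'; rewrite rmorphM mulf_neq0. Qed.

Lemma in_ideal_comb (q1 q2 : kpoly K n) P1 P2 p1 p2 :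
  in_ideal (q1 *: P1 - p1) -> in_ideal (q2 *: P2 - p2) ->
  in_ideal ((q1 * q2) *: (P1 + P2) - (q2 *: p1 + q1 *: p2)).
Proof.
move=> I1 I2; have := in_idealD (in_idealZ q2 I1) (in_idealZ q1 I2).
by rewrite !scalerBr !scalerA addrACA -opprD [q2 * q1]mulrC scalerDr.
Qed.

Lemma reducibleD b P Q : reducible b P -> reducible b Q -> reducible b (P + Q).
Proof.
move=> [q1 [p1 [q10 s1 I1]]] [q2 [p2 [q20 s2 I2]]].
exists (q1 * q2), (q2 *: p1 + q1 *: p2); split; [exact: mul_coef0_neq0| |exact: in_ideal_comb].
by move=> u /msuppD_le; rewrite mem_cat => /orP[] /msuppZ_le; [apply: s1 | apply: s2].
Qed.

Lemma reducibleZ b c P : reducible b P -> reducible b (c *: P).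
Proof.
move=> [q [p [q0 s I]]]; exists q, (c *: p); split; first exact: q0.
  by move=> u /msuppZ_le/s.
by have := in_idealZ c I; rewrite scalerBr !scalerA [c * q]mulrC.
Qed.

Lemma in_ideal_reducible b P : in_ideal P -> reducible b P.
Proof.
move=> IP; exists 1, 0; rewrite subr0 scale1r; split; last exact: IP.
  by rewrite rmorph1 oner_eq0.
by move=> u; rewrite mcoeff_msupp mcoeff0 eqxx.
Qed.

Lemma reducible_unit b (h : kpoly K n) P : h@_0 != 0 -> reducible b (h *: P) -> reducible b P.
Proof.
move=> h0 [q [p [q0 s I]]]; exists (q * h), p; split; [exact: mul_coef0_neq0|exact: s|].
by rewrite -scalerA.
Qed.

Lemma reducible_lte b c P : lte lt b c -> reducible b P -> reducible c P.
Proof.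
move=> bc [q [p [q0 s I]]]; exists q, p; split; [exact: q0| |exact: I].
by move=> u /s[pu ub]; split; [exact: pu | apply: lte_trans ub bc].
Qed.

(** If [u] is not parametric, [u = w + head_term lt g], and [d^w g] is [head_coef lt g] times [d^u]
    plus smaller terms. These are reducible by induction, and the head coefficient is absorbed into
    the denominator. *)
Lemma reducibleX u : (forall g, g \in G -> (head_coef lt g)@_0 != 0) -> reducible u 'X_[u].
Proof.
move=> h0; elim/(graded_ind lt_order): u => u IH.
have [pu|] := boolP (param u).
  exists 1, 'X_[u]; split; first by rewrite rmorph1 oner_eq0.
    by move=> v /mem_msuppXP <-; split=> //; apply: lte_refl.
  by rewrite scale1r subrr; apply: in_ideal0.
rewrite -has_predC => /hasP[g gG /=]; rewrite negbK => le.
have uE := submK le; set w := (u - _)%MM in uE.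
apply: (reducible_unit (h0 g gG)).
set D := deriv_mul w g.
have uD v : v \in msupp D -> lte lt v u.
  by move/(deriv_mul_supp_lte lt_order); rewrite uE.
have Du : D@_u = head_coef lt g by rewrite -[in LHS]uE deriv_mul_head // gbG.1.
set S := \sum_(v <- msupp D | v != u) D@_v *: 'X_[v].
have DE : D = head_coef lt g *: 'X_[u] + S.
  rewrite [LHS]mpolyE (bigID (fun v => v != u)) /= addrC; congr (_ + _).
  under eq_bigl do rewrite negbK.
  have [uS|uS] := boolP (u \in msupp D); last first.
    rewrite -Du (memN_msupp_eq0 uS) scale0r big_seq_cond big1 // => v /andP[vS /eqP vE].
    by rewrite -vE vS in uS.
  by rewrite -big_filter filter_pred1_uniq ?msupp_uniq // big_seq1 Du.
have -> : head_coef lt g *: 'X_[u] = D + (-1) *: S.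
  by rewrite scaleN1r; apply/eqP; rewrite eq_sym subr_eq -DE.
apply: reducibleD; first exact/in_ideal_reducible/in_ideal_deriv_mul.
apply: reducibleZ; rewrite /S big_seq_cond.
elim/big_rec: _ => [|v P /andP[vD ne] hP]; first exact/in_ideal_reducible/in_ideal0.
apply: reducibleD; last exact: hP.
apply: reducibleZ; have := uD v vD.
rewrite /lte (negbTE ne) /= => vu.
by apply: reducible_lte (IH v vu); rewrite /lte vu orbT.
Qed.

End Ideal.

(** * Power series *)

Lemma mcoeff0M (R : nzRingType) n :
  {morph mcoeff (0%MM : 'X_{1..n}) : p q / (p * q : {mpoly R[n]}) >-> p * q}.
Proof. exact: rmorphM. Qed.

Lemma mcoeff0_nat (R : nzRingType) n k : (k%:R : {mpoly R[n]})@_0 = k%:R.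
Proof. exact: rmorph_nat. Qed.

Definition mfact n (w : 'X_{1..n}) : nat := (\prod_(i < n) (w i)`!)%N.

Lemma mbinom_fact n (w v : 'X_{1..n}) : (v <= w)%MM ->
  (mbinom w v * (mfact v * mfact (w - v)%MM) = mfact w)%N.
Proof.
move=> /mnm_lepP le; rewrite -!big_split; apply: eq_bigr => i _ /=.
by rewrite mnmBE bin_fact.
Qed.

Lemma mffact_fact n (w v : 'X_{1..n}) :
  ((\prod_(i < n) (w i + v i) ^_ (v i)) * mfact w = mfact (w + v)%MM)%N.
Proof.
rewrite -big_split; apply: eq_bigr => i _ /=.
by rewrite mnmDE -[X in (_ * X`!)%N](addnK (v i)) ffact_fact // leq_addl.
Qed.

Lemma fps_mulpolyE (K : fieldType) n (c : kpoly K n) (g : fps K n) w k : (mdeg w < k)%N ->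
  fps_mulpoly c g w =
    \sum_(v : 'X_{1..n < k} | (bmnm v <= w)%MM) c@_v * g (w - v)%MM.
Proof.
move=> wk; rewrite /fps_mulpoly -big_mkcond.
rewrite (big_mksub_cond 'X_{1..n < k}) ?msupp_uniq //=; last first.
  by move=> v _ le; apply: leq_ltn_trans wk; rewrite -(submK le) mdegD leq_addl.
rewrite [RHS](bigID (fun v : 'X_{1..n < k} => (v : 'X_{1..n}) \in msupp c)) /=.
by rewrite [X in _ = _ + X]big1 ?addr0 // => v /andP[_ /memN_msupp_eq0->]; rewrite mul0r.
Qed.

Lemma fps_mulpoly_poly (K : fieldType) n (c q : kpoly K n) w :
  fps_mulpoly c (fun v => q@_v) w = (c * q)@_w.
Proof.
by rewrite (fps_mulpolyE _ _ (ltnSn _)) -mcoeff_poly_mul_lin.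
Qed.

Lemma fps_deriv_poly (K : fieldType) n (q : kpoly K n) u w :
  fps_deriv u (fun v => q@_v) w = (q^`M[u])@_w.
Proof.
rewrite /fps_deriv mcoeff_mderivm addmC -[RHS]mulr_natr; congr (_ * _).
by congr (_%:R); apply: eq_bigr => i _; rewrite addmC mnmDE.
Qed.

(** * Power series solutions from normal forms *)

Section FormalSolutions.
Variables (K : fieldType) (n : nat) (lt : rel 'X_{1..n}) (G : seq (pop K n)).
Hypothesis char0 : [pchar K] =i pred0.
Hypothesis lt_order : graded_term_order lt.
Hypothesis gbG : groebner_basis lt G.
Hypothesis head0 : forall g, g \in G -> (head_coef lt g)@_0 != 0.
Implicit Types (P Q : pop K n).

Lemma mfact_neq0 (w : 'X_{1..n}) : (mfact w)%:R != 0 :> K.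
Proof.
rewrite (GRing.pcharf0P _).1 // -lt0n; apply: prodn_gt0 => i.
exact: fact_gt0.
Qed.

(* [x] is the value at the origin of the [d^e]-coefficient of the normal form of [P]. *)
Definition nf_value e P (x : K) := exists q p, [/\ q@_0 != 0,
  forall u, u \in msupp p -> param lt G u, in_ideal G (q *: P - p) &
  (p@_e)@_0 = x * q@_0].

Lemma nf_valueD e P Q x y : nf_value e P x -> nf_value e Q y -> nf_value e (P + Q) (x + y).
Proof.
move=> [q1 [p1 [q10 s1 I1 E1]]] [q2 [p2 [q20 s2 I2 E2]]].
exists (q1 * q2), (q2 *: p1 + q1 *: p2); split.
- exact: mul_coef0_neq0.
- by move=> u /msuppD_le; rewrite mem_cat => /orP[] /msuppZ_le; [apply: s1 | apply: s2].
- exact: in_ideal_comb.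
rewrite mcoeffD [(q2 *: p1)@_e]mcoeffZ [(q1 *: p2)@_e]mcoeffZ mcoeffD !mcoeff0M E1 E2.
by ring.
Qed.

Lemma nf_valueZ e c P x : nf_value e P x -> nf_value e (c *: P) (c@_0 * x).
Proof.
move=> [q [p [q0 s I E]]]; exists q, (c *: p); split; first exact: q0.
- by move=> u /msuppZ_le/s.
- by have := in_idealZ c I; rewrite scalerBr !scalerA [c * q]mulrC.
by rewrite [(c *: p)@_e]mcoeffZ mcoeff0M E mulrA.
Qed.

Lemma nf_value_ideal e P : in_ideal G P -> nf_value e P 0.
Proof.
move=> IP; exists 1, 0; rewrite subr0 scale1r; split; last by rewrite !mcoeff0 mul0r.
- by rewrite rmorph1 oner_eq0.
- by move=> u; rewrite mcoeff_msupp mcoeff0 eqxx.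
exact: IP.
Qed.

(** After cross-multiplication, two normal forms differ by an ideal element with parametric support,
    which vanishes. *)
Lemma nf_value_uniq e P x y : nf_value e P x -> nf_value e P y -> x = y.
Proof.
move=> [q1 [p1 [q10 s1 I1 E1]]] [q2 [p2 [q20 s2 I2 E2]]].
have I : in_ideal G (q1 *: p2 - q2 *: p1).
  have := in_idealB (in_idealZ q2 I1) (in_idealZ q1 I2).
  by rewrite !scalerBr !scalerA [q2 * q1]mulrC opprB addrC addrA subrK.
have /eqP : q1 *: p2 - q2 *: p1 = 0.
  apply: (in_ideal_param_eq0 lt_order gbG I) => u /msuppB_le.
  by rewrite mem_cat => /orP[] /msuppZ_le; [apply: s2 | apply: s1].
rewrite subr_eq0 => /eqP /(congr1 (fun p : pop K n => (p@_e)@_0)).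
rewrite [(q1 *: p2)@_e]mcoeffZ [(q2 *: p1)@_e]mcoeffZ !mcoeff0M E1 E2 => E.
apply: (mulIf (mulf_neq0 q10 q20)).
transitivity (q2@_0 * (x * q1@_0)); first by ring.
by rewrite -E; ring.
Qed.

Lemma nf_value_param e u : param lt G u -> nf_value e 'X_[u] (u == e)%:R.
Proof.
move=> pu; exists 1, 'X_[u]; split.
- by rewrite rmorph1 oner_eq0.
- by move=> v /mem_msuppXP <-.
- by rewrite scale1r subrr; apply: in_ideal0.
by rewrite mcoeffX rmorph1 mulr1 rmorph_nat.
Qed.

(** The normal form of [d^u] has exponents at most [u], so [d^e] does not occur. This is what makes
    [e] the initial exponent of the solution. *)
Lemma nf_value_lt e u : lt u e -> nf_value e 'X_[u] 0.
Proof.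
move=> ue; have [q [p [q0 s I]]] := reducibleX lt_order gbG u head0.
exists q, p; split; [exact: q0 | by move=> v /s[] | exact: I |].
have ep : e \notin msupp p.
  by apply/negP => /s[_] /(lteNlt lt_order); rewrite ue.
by rewrite mul0r (memN_msupp_eq0 ep) mcoeff0.
Qed.

Lemma nf_valueX e u : exists x, nf_value e 'X_[u] x.
Proof.
have [q [p [q0 s I]]] := reducibleX lt_order gbG u head0.
exists ((p@_e)@_0 / q@_0), q, p; split; [exact: q0 | by move=> v /s[] | exact: I |].
by rewrite divfK.
Qed.

(** The last clause makes the solutions for distinct parametric exponents linearly independent. *)
Lemma fps_solution_exists e : param lt G e -> exists f : fps K n,
  [/\ fps_solution G f, f e != 0, forall u, lt u e -> f u = 0 &
      forall u, param lt G u -> u != e -> f u = 0].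
Proof.
move=> pe; have [F hF] := functional_choice _ (nf_valueX e).
(* [Phi] evaluates coefficients at the origin and extends [F] linearly; by uniqueness of values it
   vanishes on the ideal. *)
pose Phi P := \sum_(u <- msupp P) (P@_u)@_0 * F u.
have valPhi P : nf_value e P (Phi P).
  rewrite {1}[P]mpolyE /Phi; elim/big_rec2: _ => [|u x Q _ IH].
    exact/nf_value_ideal/in_ideal0.
  by apply: nf_valueD IH; apply: nf_valueZ.
exists (fun u => F u / (mfact u)%:R); split=> [g gG w||u ue|u pu ue].
- apply: (mulfI (mfact_neq0 w)); rewrite mulr0.
  transitivity (Phi (deriv_mul w g)); last first.
    exact/(nf_value_uniq (valPhi _))/nf_value_ideal/in_ideal_deriv_mul.
  have PhiF : (forall u, (0 : kpoly K n)@_0 * F u = 0) /\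
      forall u, {morph (fun c : kpoly K n => c@_0 * F u) : a b / a + b}.
    by split=> [u|u a b]; rewrite ?mcoeff0 ?mul0r // mcoeffD mulrDl.
  rewrite /Phi /deriv_mul (sum_msupp_sum PhiF.1 PhiF.2) /fps_apply mulr_sumr.
  apply: eq_bigr => v _.
  rewrite /deriv_mul_term (sum_msupp_sum PhiF.1 PhiF.2).
  rewrite (fps_mulpolyE _ _ (ltnSn _)) mulr_sumr; apply: eq_bigr => w' le.
  rewrite (sum_msuppZX (F := fun u (c : kpoly K n) => c@_0 * F u) PhiF.1) mcoeff0M.
  (* At the origin, the derivative of order [w'] of a coefficient is [w'!] times its [x^w']
     coefficient; with [binom(w, w') w'! (w - w')! = w!] the terms agree one by one. *)
  rewrite mcoeff0_nat mcoeff_mderivm addm0 -mulr_natr.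
  have -> : (\prod_(i < n) (bmnm w' i) ^_ (bmnm w' i) = mfact w')%N.
    by apply: eq_bigr => i _; rewrite ffactnn.
  rewrite /fps_deriv -(mffact_fact _ v) -(mbinom_fact le) !natrM.
  have := mfact_neq0 (w - w')%MM; have := mfact_neq0 ((w - w') + v)%MM.
  rewrite -mffact_fact natrM mulf_eq0 negb_or => /andP[n1 _] n2.
  by field; rewrite n1 n2.
- rewrite mulf_neq0 ?invr_eq0 ?mfact_neq0 //.
  have := nf_value_param e pe; rewrite eqxx => h.
  by rewrite (nf_value_uniq (hF e) h) oner_eq0.
- by rewrite (nf_value_uniq (hF u) (nf_value_lt ue)) mul0r.
have := nf_value_param e pu; rewrite (negbTE ue) => h.
by rewrite (nf_value_uniq (hF u) h) mul0r.
Qed.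

End FormalSolutions.

(** * Truncated power series *)

Section Truncation.
Variables (K : fieldType) (n : nat).
Implicit Types p q : kpoly K n.

(** Membership in the [N]-th power of the maximal ideal at the origin. *)
Definition low N p := forall w, (mdeg w < N)%N -> p@_w = 0.

Lemma low_sum N (I : Type) (s : seq I) (F : I -> kpoly K n) :
  (forall i, low N (F i)) -> low N (\sum_(i <- s) F i).
Proof. by move=> h w wN; rewrite raddf_sum big1 // => i _; apply: h. Qed.

Lemma lowM N p q : low N p -> low N (p * q).
Proof.
move=> h w wN; rewrite mcoeffM big1 // => -[u v] /= /eqP e.
by rewrite h ?mul0r //; apply: leq_ltn_trans wN; rewrite [X in (_ <= mdeg X)%N]e mdegD leq_addr.
Qed.

(** Truncation turns solutions into polynomials, so that determinants over the polynomial ring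
    apply. *)
Definition trunc D (f : fps K n) : kpoly K n := \sum_(v : 'X_{1..n < D}) f v *: 'X_[v].

Lemma trunc_coef D f w : (mdeg w < D)%N -> (trunc D f)@_w = f w.
Proof. exact: mcoeff_mpoly. Qed.

Lemma fps_apply_trunc D (g : pop K n) f w : (mdeg w + msize g < D)%N ->
  (\sum_(u <- msupp g) g@_u * (trunc D f)^`M[u])@_w = fps_apply g f w.
Proof.
move=> lt_D; rewrite raddf_sum /fps_apply; apply: eq_big_seq => u ug /=.
rewrite -fps_mulpoly_poly !(fps_mulpolyE _ _ (ltnSn _)); apply: eq_bigr => v le.
congr (_ * _); rewrite -fps_deriv_poly /fps_deriv trunc_coef //.
apply: leq_ltn_trans lt_D; rewrite mdegD leq_add ?mdegB //.
exact/ltnW/msize_mdeg_lt.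
Qed.

Lemma trunc_deriv0 D f u : (mdeg u < D)%N -> ((trunc D f)^`M[u])@_0 = f u * (mfact u)%:R.
Proof.
move=> uD; rewrite mcoeff_mderivm addm0 trunc_coef // mulr_natr; congr (_ *+ _).
by apply: eq_bigr => i _; rewrite ffactnn.
Qed.

End Truncation.

(** * From solutions back to head coefficients *)

Section Converse.
Variables (K : fieldType) (n : nat) (lt : rel 'X_{1..n}) (G : seq (pop K n)).
Hypothesis char0 : [pchar K] =i pred0.
Hypothesis lt_order : graded_term_order lt.
Hypothesis redG : reduced lt G.
Hypothesis primG : forall g, g \in G -> primitive g.
Hypothesis G0 : forall g, g \in G -> g != 0.

(** Reducedness excludes the heads of the other elements; the head of [g] itself is larger than [u],
    hence does not divide it. *)
Lemma reduced_param g u : g \in G -> u \in msupp g -> u != head_term lt g -> param lt G u.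
Proof.
move=> gG ug une; apply/allP => g' g'G.
have [e|ne] := eqVneq (index g G) (index g' G).
  have <- : g = g' by rewrite -[g](nth_index 0 gG) e nth_index.
  apply/negP => /(lem_lte lt_order)/(lteNlt lt_order).
  by have := head_term_max lt_order ug; rewrite /lte (negbTE une) /= => ->.
have lg : (index g G < size G)%N by rewrite index_mem.
have lg' : (index g' G < size G)%N by rewrite index_mem.
have := @redG (Ordinal lg) (Ordinal lg') ne u.
by rewrite /= !nth_index //; apply.
Qed.

Variables (fs : seq (fps K n)) (es : seq 'X_{1..n}).
Local Notation f_ := (nth (fun _ => 0) fs).
Local Notation e_ := (nth 0%MM es).
Hypothesis es_uniq : uniq es.
Hypothesis esE : forall u, u \in es = param lt G u.
Hypothesis fs_init : forall k, (k < size es)%N -> initial_exp lt (f_ k) (e_ k).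
Hypothesis fs_sol : forall k, (k < size es)%N -> fps_solution G (f_ k).

(* Up to the order of [es], this matrix is triangular. *)
Lemma init_det_neq0 :
  \det (\matrix_(v < size es, j < size es) (f_ j (e_ v) * (mfact (e_ v))%:R)) != 0.
Proof.
apply/negP => /det0P[y y0 yM].
have [v1 yv1] : exists v1, y 0 v1 != 0.
  by move/rV0Pn: y0.
(* Take the largest exponent at which [y] is nonzero. In that column the entries at smaller
   exponents vanish, since [f_ v0] has no term below [e_ v0]; only the diagonal entry remains. *)
pose s := [seq e_ (val v) | v <- enum 'I_(size es) & y 0 v != 0].
have [ms max] := lt_max_spec lt_order (e_ v1) s.
have [v0 yv0 mE] : exists2 v0 : 'I_(size es), y 0 v0 != 0 &
    foldr (fun u acc => if lt acc u then u else acc) (e_ v1) s = e_ v0.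
  move: ms; rewrite inE => /orP[/eqP->|/mapP[v]]; first by exists v1.
  by rewrite mem_filter => /andP[yv _] ->; exists v.
have := congr1 (fun A : 'rV__ => A 0 v0) yM; rewrite !mxE (bigD1 v0) //= big1 => [|v ne].
  rewrite addr0 mxE => /eqP; rewrite !mulf_eq0 (negbTE yv0) (negbTE (mfact_neq0 char0 _)) orbF /=.
  by rewrite (negbTE (fs_init (ltn_ord v0)).1).
rewrite mxE; have [->|yv] := eqVneq (y 0 v) 0; first by rewrite mul0r.
have [->|fv] := eqVneq (f_ v0 (e_ v)) 0; first by rewrite mul0r mulr0.
have [/eqP|ltv] := (fs_init (ltn_ord v0)).2 _ fv.
  by rewrite nth_uniq // => /eqP/val_inj e; rewrite e eqxx in ne.
have /max : e_ v \in e_ v1 :: s.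
  by rewrite in_cons (map_f (fun v : 'I__ => e_ v)) ?orbT // mem_filter yv mem_enum.
by rewrite mE => /(lteNlt lt_order); rewrite ltv.
Qed.

Lemma head_coef_neq0_at0 g : g \in G -> (head_coef lt g)@_0 != 0.
Proof.
move=> gG; have g0 := G0 gG; set h := head_coef lt g; set ht := head_term lt g.
have htS : ht \in msupp g by apply: head_term_supp.
have h0 : h != 0 by rewrite -mcoeff_msupp.
pose F (k : 'I_(size (msupp g))) : kpoly K n := g@_(nth 0%MM (msupp g) k).
have Fidx u (uS : u \in msupp g) : exists k, F k = g@_u.
  have lt_u : (index u (msupp g) < size (msupp g))%N by rewrite index_mem.
  by exists (Ordinal lt_u); rewrite /F nth_index.
apply: (@congr_prim_unit K n _ h F) => //.
- by have [k kE] := Fidx _ htS; exists k; rewrite kE.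
- move=> d dF; apply: (primG gG) => u.
  have [/Fidx[k <-]|uS] := boolP (u \in msupp g); first exact: dF.
  by rewrite (memN_msupp_eq0 uS); apply: rdvd0.
(* Large enough to apply [g] correctly below degree [N], and for the values at the origin of all
   derivatives of order in [es]. *)
move=> N; pose D := (N + msize g + \max_(e <- es) mdeg e).+1.
have esD (v : 'I_(size es)) : (mdeg (e_ v) < D)%N.
  rewrite ltnS; apply: leq_trans (leq_addl _ _).
  by apply: leq_bigmax_seq; rewrite ?mem_nth.
pose A := \matrix_(v < size es, j < size es) (trunc D (f_ j))^`M[e_ v].
pose c := \row_(v < size es) g@_(e_ v).
pose b (j : 'I_(size es)) := (trunc D (f_ j))^`M[ht].
(* The equations [g(f_j) = 0], with the head term split off, up to terms of degree at least [N]. *)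
have lowE j : low N ((c *m A) 0 j + h * b j).
  move=> w wN.
  have -> : (c *m A) 0 j + h * b j = \sum_(u <- msupp g) g@_u * (trunc D (f_ j))^`M[u].
    rewrite (bigD1_seq ht) ?msupp_uniq //= addrC; congr (_ + _).
    have -> : (c *m A) 0 j = \sum_(v < size es) g@_(e_ v) * (trunc D (f_ j))^`M[e_ v].
      by rewrite mxE; apply: eq_bigr => v _; rewrite !mxE.
    rewrite -(big_mkord xpredT (fun v => g@_(e_ v) * (trunc D (f_ j))^`M[e_ v])).
    rewrite -(big_nth 0%MM xpredT (fun u => g@_u * (trunc D (f_ j))^`M[u])).
    rewrite (bigID (fun u => u \in msupp g)) /= [X in _ + X]big1 ?addr0; last first.
      by move=> u /memN_msupp_eq0 ->; rewrite mul0r.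
    rewrite -big_filter -[RHS]big_filter; apply: perm_big.
    apply: uniq_perm; rewrite ?filter_uniq ?msupp_uniq // => u.
    rewrite !mem_filter andbC; have [uS|//] := boolP (u \in msupp g); last by rewrite !andbF.
    rewrite !andbT esE; have [->|ne] := eqVneq u ht; last exact: reduced_param ne.
    by apply/negP => /allP /(_ g gG); rewrite lepm_refl.
  rewrite fps_apply_trunc; first exact: fs_sol.
  by rewrite ltnS (leq_trans _ (leq_addr _ _)) // leq_add2r ltnW.
exists (\det A).
  have -> : (\det A)@_0 = \det (map_mx (mcoeff 0) A) by rewrite det_map_mx.
  suff -> : map_mx (mcoeff 0) A =
    \matrix_(v < size es, j < size es) (f_ j (e_ v) * (mfact (e_ v))%:R) by exact: init_det_neq0.
  by apply/matrixP => v j; rewrite !mxE trunc_deriv0.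
move=> k; set u := nth 0%MM (msupp g) k.
have [uE|une] := eqVneq u ht.
  by exists (\det A) => w _; rewrite /F -/u uE mulrC subrr mcoeff0.
have ues : u \in es by rewrite esE; apply: reduced_param une; rewrite ?mem_nth.
have lt_u : (index u es < size es)%N by rewrite index_mem.
pose v := Ordinal lt_u.
(* Cramer's rule: multiplying the system by the adjugate of [A] gives [det A c = - h b adj A] up to
   degree [N]. *)
exists (- \sum_j b j * \adj A j v).
have -> : \det A * F k - h * - (\sum_j b j * \adj A j v) =
    \sum_j ((c *m A) 0 j + h * b j) * \adj A j v.
  have -> : \det A * F k = (c *m A *m \adj A) 0 v.
    by rewrite -mulmxA mul_mx_adj mul_mx_scalar !mxE /F -/u nth_index.
  rewrite mulrN opprK mulr_sumr [(_ *m \adj A) 0 v]mxE -big_split; apply: eq_bigr => j _.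
  by rewrite /= mulrA -mulrDl.
by apply: low_sum => j; apply: lowM.
Qed.

End Converse.

(** * Ordinary points and the equivalence *)

Lemma meval0 (K : fieldType) n (p : kpoly K n) : p.@[fun=> 0] = p@_0.
Proof.
apply: (@mpoly_rmorph_ext _ _ _ (meval (fun=> 0)) (mcoeff 0)) => [c|j] /=.
  by rewrite mevalC mcoeffC eqxx mulr1.
by rewrite mevalXU mcoeffX mnm1_eq0.
Qed.

(** [origin_ordinary] speaks of every lcm, so the forward direction needs one to exist; each head
    coefficient divides it. Backwards, an lcm divides the product of the head coefficients. *)
Lemma origin_ordinaryP (K : fieldType) n (lt : rel 'X_{1..n}) (G : seq (pop K n)) :
  graded_term_order lt -> (forall g, g \in G -> g != 0) ->
  origin_ordinary lt G <-> (forall g, g \in G -> (head_coef lt g)@_0 != 0).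
Proof.
move=> lto G0; split=> [ord g gG|h L [_ minL]].
  have [L L0 [dvdL minL]] : exists2 L, L != 0 &
      (forall h, h \in map (head_coef lt) G -> rdvd h L) /\
      (forall M, (forall h, h \in map (head_coef lt) G -> rdvd h M) -> rdvd L M).
    apply: (has_lcm (@has_gcd_mpoly K n)).
    apply/allP => _ /mapP[g' g'G ->].
    by rewrite -mcoeff_msupp; apply: head_term_supp => //; apply: G0.
  have := ord L (conj dvdL minL); rewrite meval0.
  have [q ->] := dvdL _ (map_f (head_coef lt) gG).
  by rewrite mcoeff0M mulf_eq0 negb_or => /andP[].
rewrite meval0; have [|q qE] := minL (\prod_(g <- G) head_coef lt g).
  move=> _ /mapP[g gG ->]; rewrite (big_rem g) //=.
  by exists (\prod_(y <- rem g G) head_coef lt y); rewrite mulrC.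
have : (\prod_(g <- G) head_coef lt g)@_0 != 0.
  rewrite (rmorph_prod (mcoeff 0)) prodf_seq_neq0; apply/allP => g gG.
  by rewrite h.
by rewrite qE mcoeff0M mulf_eq0 negb_or => /andP[].
Qed.

Theorem mainTheorem5 (K : fieldType) (n : nat) (lt : rel 'X_{1..n})
    (G : seq (pop K n)) :
  [pchar K] =i pred0 ->
  graded_term_order lt ->
  groebner_basis lt G ->
  reduced lt G ->
  (forall g, g \in G -> primitive g) ->
  D_finite (map (@pop_to_rop K n) G) ->
  (origin_ordinary lt G <->
   exists (fs : seq (fps K n)) (es : seq 'X_{1..n}),
     [/\ size fs = size es /\ uniq es,
         (forall u, u \in es <-> param_exp lt G u),
         (forall k, (k < size fs)%N ->
            initial_exp lt (nth (fun _ => 0) fs k) (nth 0%MM es k)),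
         (forall k, (k < size fs)%N -> fps_solution G (nth (fun _ => 0) fs k)) &
         fps_lin_indep fs]).
Proof.
move=> char0 lto gb red prim Dfin; rewrite origin_ordinaryP //; last exact: gb.1.
split=> [h0|[fs [es [[sz us] esP init sol _]]] g gG]; last first.
  apply: (@head_coef_neq0_at0 _ _ _ _ char0 lto red prim gb.1 fs es us) => //.
  - by move=> u; apply/idP/idP => [/esP/paramP//|/paramP/esP].
  - by rewrite -sz.
  by rewrite -sz.
have [es [us esE]] := D_finite_param lto gb Dfin.
(* The zero series stands in at nonparametric exponents, so that a total choice function exists. *)
have ex e : exists f : fps K n, param lt G e ->
    [/\ fps_solution G f, f e != 0, forall u, lt u e -> f u = 0 &
        forall u, param lt G u -> u != e -> f u = 0].
  have [pe|] := boolP (param lt G e); last by exists (fun=> 0).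
  by have [f hf] := fps_solution_exists char0 lto gb h0 pe; exists f.
have [f hf] := functional_choice _ ex.
have fk k : (k < size es)%N ->
    nth (fun=> 0) (map f es) k = f (nth 0%MM es k) /\ param lt G (nth 0%MM es k).
  by move=> lt_k; rewrite (nth_map 0%MM) // -esE mem_nth.
exists (map f es), es; split.
- by rewrite size_map.
- by move=> u; rewrite esE; split=> /paramP.
- move=> k; rewrite size_map => /fk[-> /hf[_ fe flt _]]; split=> // v fv.
  have [_ _ tot _ _] := lto.
  have [->|/tot/orP[vlt|]] := eqVneq v (nth 0%MM es k); [by left| |by right].
  by rewrite flt ?eqxx in fv.
- by move=> k; rewrite size_map => /fk[-> /hf[]].
move=> c hc k; have lt_size (j : 'I_(size (map f es))) : (j < size es)%N.
  by rewrite -(size_map f es).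
(* At the [k]-th exponent every other series vanishes, which isolates [c k]. *)
have := hc (nth 0%MM es k); have [fkE pk] := fk k (lt_size k).
rewrite (bigD1 k) //= fkE big1 => [|j ne].
  have [_ fe _ _] := hf _ pk.
  by rewrite addr0 => /eqP; rewrite mulf_eq0 (negbTE fe) orbF => /eqP.
have [-> pj] := fk j (lt_size j); have [_ _ _ -> //] := hf _ pj; first by rewrite mulr0.
by rewrite nth_uniq ?lt_size // eq_sym.
Qed.
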